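(* There is an absolute constant $C>0$ such that the following holds. Let $\mathcal{F}_1,\dots,\mathcal{F}_t$ be set systems on an $n$-point ground set $V$, and let $\mathcal{F}$ be a set system on $V$ such that for each $F\in\mathcal{F}$ there are pairwise disjoint sets $F_1\in\mathcal{F}_1,\dots,F_t\in\mathcal{F}_t$ with $F=F_1\cup\cdots\cup F_t$. Then \[ \operatorname{herdisc}\mathcal{F}\le C\sqrt{\log|\mathcal{F}|}\sum_{i=1}^t(\log|\mathcal{F}_i|)\operatorname{herdisc}\mathcal{F}_i . \]
   Context: For a set system $\mathcal{F}$ on ground set $V$, $\operatorname{disc}\mathcal{F}=\min_{x\in\{-1,1\}^V}\max_{F\in\mathcal{F}}\bigl|\sum_{v\in F}x_v\bigr|$, and $\operatorname{herdisc}\mathcal{F}=\max_{J\subseteq V}\operatorname{disc}(\mathcal{F}|_J)$, where $\mathcal{F}|_J=\{F\cap J:F\in\mathcal{F}\}$.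
   Formalization: The logarithms log|F| and log|F_i| are replaced by ln(|F|+1) and ln(|F_i|+1), because the stated bound fails when |F|=1 (one point, F=F_1={V}: left side 1, right side 0) and log 0 is undefined for empty systems. *)

(* Defs.v *)
From mathcomp Require Import all_boot all_order all_algebra.
From Stdlib Require Import Reals.
Set Implicit Arguments. Unset Strict Implicit. Unset Printing Implicit Defensive.

Section Disc.
Variable V : finType.

Definition sgnc (x : {ffun V -> bool}) (v : V) : int :=
  if x v then (1 : int)%Z else (-1 : int)%Z.

Definition set_disc (x : {ffun V -> bool}) (S : {set V}) : nat :=
  absz (\big[@GRing.add int/GRing.zero]_(v in S) sgnc x v).

(* max_{S in F} |sum_{v in S} x_v|  (0 for an empty family) *)
Definition col_disc (F : {set {set V}}) (x : {ffun V -> bool}) : nat :=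
  \max_(S in F) set_disc x S.

(* disc F = min over colourings x in {-1,1}^V of col_disc F x.
   The neutral element #|V| is harmless: col_disc F x <= #|V| always. *)
Definition disc (F : {set {set V}}) : nat :=
  \big[minn/#|V|]_(x : {ffun V -> bool}) col_disc F x.

Definition restrict (F : {set {set V}}) (J : {set V}) : {set {set V}} :=
  [set S :&: J | S in F].

Definition herdisc (F : {set {set V}}) : nat :=
  \max_(J : {set V}) disc (restrict F J).

End Disc.

(* Main.v *)
(** A factorization [F = B C] of the incidence matrix whose rows of [B] and columns of
    [C] have squared length at most [r] (so that the gamma_2 norm is at most [r]) is the
    bridge between the [F_i] and [F].

    Lower bound. If [herdisc F_i = h], every [k x k] minor of the incidence matrix is at
    most [(3 h)^k]: halving with the colourings of [F_i] moves every integer vector into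
    the cube [[-h, h]^k] modulo the lattice generated by the columns.  By Cauchy-Binet,
    after weighting rows and columns by probabilities, the [k] largest singular values
    have product at most [(3 h)^k / k!], so the trace norm is [O(h log |F_i|)]; a minimax
    argument over the weights yields a factorization with [r = O(h log |F_i|)].

    Union. Stacking the factorizations of the [F_i] factorizes [F], as the incidence
    vector of a disjoint union is the sum of the incidence vectors of its parts.

    Upper bound. The Gram-Schmidt walk (Bansal-Dadush-Garg-Lovett) on the columns of [C]
    ends in a colouring whose image under [C] is subgaussian.  It is derandomized here:
    at each step one of the two moves does not increase
    [\sum_t w_t exp ((e_t - a_t^2) / 2) E exp (a_t (X - y))], where [e_t] is the squared
    length of the projection of the test vector [theta_t] on the span of the live columns,
    [a_t] its product with the residual of the pivot column, [y] the current value of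
    the pivot and [X = +1, -1] a random sign of mean [y]. *)

From Stdlib Require Import Reals Lra.
From mathcomp Require Import all_boot all_order all_algebra fingroup perm.
From mathcomp Require Import Rstruct complex.
Require Import Defs.

Set Implicit Arguments. Unset Strict Implicit. Unset Printing Implicit Defensive.
Import Order.TTheory GRing.Theory Num.Theory.

(** * The potential of the walk *)

Section Mgf.
Local Open Scope R_scope.

(* [mgf y a] is the moment generating function at [a] of the centred variable with
   values [1 - y] and [-1 - y]. *)
Definition mgf (y a : R) : R :=
  (1 + y) / 2 * exp ((1 - y) * a) + (1 - y) / 2 * exp (- ((1 + y) * a)).

(** [den y] is the moment generating function of the uncentred sign of mean [y]; [num y] is its
    derivative, and the derivative of [num y] is [den y] again. *)
Let den y a := (1 + y) / 2 * exp a + (1 - y) / 2 * exp (- a).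
Let num y a := (1 + y) / 2 * exp a - (1 - y) / 2 * exp (- a).

Let mgfE y a : mgf y a = den y a * exp (- (y * a)).
Proof.
have mul_exp p q r : p * exp q * exp r = p * exp (q + r) by rewrite exp_plus; ring.
rewrite /mgf /den [RHS]Rmult_plus_distr_r !mul_exp.
by congr (_ * exp _ + _ * exp _); ring.
Qed.

(** The weights [(1 + y) / 2] and [(1 - y) / 2] are affine in [y], and [exp (d * a)] undoes the
    change of centring, so the left side is affine in [d]. *)
Lemma mgf_shift y d a : exp (d * a) * mgf (y + d) a =
  mgf y a + d * (exp (- (y * a)) * ((exp a - exp (- a)) / 2)).
Proof.
rewrite !mgfE /den (_ : - (y * a) = d * a + - ((y + d) * a)); last by ring.
rewrite exp_plus; field.
Qed.

Lemma mgf_sym y a : mgf (- y) (- a) = mgf y a.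
Proof.
rewrite /mgf Rplus_comm (_ : 1 - - y = 1 + y); last by ring.
rewrite (_ : 1 + - y = 1 - y); last by ring.
by congr (_ * exp _ + _ * exp _); ring.
Qed.

Lemma mgf_end y a : y = 1 \/ y = -1 -> mgf y a = 1.
Proof.
have e0 x : x = 0 -> exp x = 1 by move=> ->; exact: exp_0.
case=> ->; rewrite /mgf.
- by rewrite (e0 ((1 - 1) * a)); [field | ring].
- by rewrite (e0 (- ((1 + -1) * a))); [field | ring].
Qed.

Lemma mgf0 y : mgf y 0 = 1.
Proof. by rewrite /mgf !Rmult_0_r Ropp_0 exp_0; field. Qed.

Let den_gt0 y a : -1 <= y <= 1 -> 0 < den y a.
Proof.
move=> y1; rewrite /den; have := exp_pos a; have := exp_pos (- a).
move: (exp a) (exp (- a)) => p q p0 q0; nra.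
Qed.

Lemma mgf_gt0 y a : -1 <= y <= 1 -> 0 < mgf y a.
Proof.
by move=> y1; rewrite mgfE; apply: Rmult_lt_0_compat; [exact: den_gt0 | exact: exp_pos].
Qed.

Let comb_derive c d a : derivable_pt_lim (fun x => c * exp x + d * exp (- x)) a
  (c * exp a - d * exp (- a)).
Proof.
have -> : c * exp a - d * exp (- a) = c * exp a + d * (exp (- a) * -1) by ring.
apply: derivable_pt_lim_plus.
  exact: (derivable_pt_lim_scal exp c a _ (derivable_pt_lim_exp a)).
apply: (derivable_pt_lim_scal (fun x => exp (- x)) d a).
apply: (derivable_pt_lim_comp Ropp exp a (-1) (exp (- a))).
  exact: (derivable_pt_lim_opp id a 1 (derivable_pt_lim_id a)).
exact: derivable_pt_lim_exp.
Qed.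

Let den_derive y a : derivable_pt_lim (den y) a (num y a).
Proof. exact: comb_derive. Qed.

Let num_derive y a : derivable_pt_lim (num y) a (den y a).
Proof.
have -> : den y a = (1 + y) / 2 * exp a - - ((1 - y) / 2) * exp (- a).
  by rewrite /den; ring.
apply: derivable_pt_lim_ext (comb_derive _ _ _) => x.
by rewrite /num; ring.
Qed.

Let nondecr f f' a b : a <= b ->
  (forall c, a <= c <= b -> derivable_pt_lim f c (f' c)) ->
  (forall c, a <= c <= b -> 0 <= f' c) -> f a <= f b.
Proof.
case=> [ab|->] df f'0; last by lra.
have [c [E [ac cb]]] := MVT_cor2 f f' a b ab df.
have : 0 <= f' c by apply: f'0; lra.
move=> H; have : 0 <= f' c * (b - a) by apply: Rmult_le_pos; lra.
lra.
Qed.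

(** [num y a / den y a] is the mean of the exponentially tilted sign: it equals [y] at [a = 0], and
    its derivative, the variance [1 - (num y a / den y a)^2], is at most 1. *)
Let num_le y a : -1 <= y <= 1 -> 0 <= a -> num y a <= (y + a) * den y a.
Proof.
move=> y1 a0.
have d0 c := den_gt0 c y1.
have : 0 - num y 0 / den y 0 <= a - num y a / den y a.
  apply: (nondecr (f := fun c => c - num y c / den y c)
    (f' := fun c => 1 - (den y c * den y c - num y c * num y c) /
     (den y c)²)) => // c _.
    apply: (derivable_pt_lim_minus id); first exact: derivable_pt_lim_id.
    apply: derivable_pt_lim_div => //; have := d0 c; lra.
  have dc := d0 c; rewrite (_ : 1 - _ = (num y c / den y c)²).
    exact: Rle_0_sqr.
  rewrite /Rsqr; field; lra.
have -> : num y 0 / den y 0 = y.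
  by rewrite /num /den Ropp_0 exp_0; field; lra.
have da := d0 a => H.
have -> : num y a = num y a / den y a * den y a by field; lra.
apply: Rmult_le_compat_r; lra.
Qed.

Lemma mgf_nondecr y a b : -1 <= y <= 1 -> 0 <= a <= b -> mgf y a <= mgf y b.
Proof.
move=> y1 [a0 ab]; rewrite !mgfE.
apply: (nondecr (f := fun a => den y a * exp (- (y * a)))
  (f' := fun c => num y c * exp (- (y * c)) + den y c * (exp (- (y * c)) * (- y)))) => // c [ac cb].
  apply: derivable_pt_lim_mult; first exact: den_derive.
  apply: (derivable_pt_lim_comp (fun x => - (y * x)) exp c); last exact: derivable_pt_lim_exp.
  have -> : - y = - (y * 1) by ring.
  apply: (derivable_pt_lim_opp (fun x => y * x)).
  exact: (derivable_pt_lim_scal id y c _ (derivable_pt_lim_id c)).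
have -> : num y c * exp (- (y * c)) + den y c * (exp (- (y * c)) * - y) =
    (1 - y * y) / 2 * (exp c - exp (- c)) * exp (- (y * c)).
  by rewrite /num /den; field.
apply: Rmult_le_pos; last exact: Rlt_le (exp_pos _).
apply: Rmult_le_pos; first by nra.
have : exp (- c) <= exp c; last by lra.
have [->|lt] : - c = c \/ - c < c by lra.
  by lra.
exact/Rlt_le/exp_increasing.
Qed.

(** The logarithmic derivative of [mgf y c * exp (- (c * c / 2))] is [num y c / den y c - y - c],
    nonpositive by [num_le]. *)
Lemma mgf_gauss_nonincr y a b : -1 <= y <= 1 -> 0 <= a <= b ->
  mgf y b * exp (- (b * b / 2)) <= mgf y a * exp (- (a * a / 2)).
Proof.
move=> y1 [a0 ab].
pose e x := exp (- (y * x) - x * x / 2).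
have E x : mgf y x * exp (- (x * x / 2)) = den y x * e x.
  by rewrite mgfE /e Rmult_assoc -exp_plus.
rewrite !E; apply: Ropp_le_cancel.
apply: (nondecr (f := fun a => - (den y a * e a))
  (f' := fun c => - (num y c * e c + den y c * (e c * (- y - c))))) => // c [ac cb].
  apply: (derivable_pt_lim_opp (fun x => den y x * e x)).
  apply: derivable_pt_lim_mult; first exact: den_derive.
  apply: (derivable_pt_lim_comp (fun x => - (y * x) - x * x / 2) exp c);
    last exact: derivable_pt_lim_exp.
  apply: derivable_pt_lim_minus.
    have -> : - y = - (y * 1) by ring.
    apply: (derivable_pt_lim_opp (fun x => y * x)).
    exact: (derivable_pt_lim_scal id y c _ (derivable_pt_lim_id c)).
  have D : derivable_pt_lim (fun x => / 2 * (x * x)) c (/ 2 * (1 * c + c * 1)).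
    apply: (derivable_pt_lim_scal (fun x => x * x)).
    exact: (derivable_pt_lim_mult id id c 1 1 (derivable_pt_lim_id c) (derivable_pt_lim_id c)).
  rewrite (_ : / 2 * (1 * c + c * 1) = c) in D; last by field.
  by apply: derivable_pt_lim_ext D => x; field.
have e0 : 0 < e c by exact: exp_pos.
have H : num y c <= (y + c) * den y c by apply: num_le => //; lra.
have -> : - (num y c * e c + den y c * (e c * (- y - c))) =
  ((y + c) * den y c - num y c) * e c by ring.
apply: Rmult_le_pos; lra.
Qed.

Lemma mgf_le_gauss y a : -1 <= y <= 1 -> mgf y a * exp (- (a * a / 2)) <= 1.
Proof.
move=> y1.
have pos z b : -1 <= z <= 1 -> 0 <= b -> mgf z b * exp (- (b * b / 2)) <= 1.
  move=> z1 b0; have := @mgf_gauss_nonincr z 0 b z1.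
  rewrite mgf0 (_ : - (0 * 0 / 2) = 0); last by field.
  by rewrite exp_0 Rmult_1_r; apply; lra.
have [a0|a0] : 0 <= a \/ 0 <= - a by lra.
  exact: pos.
rewrite -mgf_sym (_ : a * a = - a * - a); last by ring.
by apply: pos; lra.
Qed.

Lemma exp_le x z : x <= z -> exp x <= exp z.
Proof. by case=> [/exp_increasing /Rlt_le|->] //; lra. Qed.

Lemma mgf_ge1 y a : -1 <= y <= 1 -> 1 <= mgf y a.
Proof.
move=> y1.
have [a0|a0] : 0 <= a \/ 0 <= - a by lra.
  by rewrite -(mgf0 y); apply: mgf_nondecr => //; lra.
by rewrite -mgf_sym -(mgf0 (- y)); apply: mgf_nondecr => //; lra.
Qed.

(** By symmetry [a >= 0]. For [b >= 0] the damped function decreases; for [b < 0 <= a + b] the [mgf]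
    factor decreases and [D] pays for the exponent; for [a + b < 0] the left side is at most 1,
    while [D >= 2 a^2] makes the right side at least 1. *)
Lemma mgf_transition y a b D : -1 <= y <= 1 -> 0 <= D -> - (2 * (a * b)) <= D ->
  mgf y (a + b) * exp (- ((a + b) * (a + b) / 2)) <=
  mgf y a * exp (- (a * a / 2)) * exp (D / 2).
Proof.
have pos z c d : -1 <= z <= 1 -> 0 <= D -> - (2 * (c * d)) <= D -> 0 <= c ->
    mgf z (c + d) * exp (- ((c + d) * (c + d) / 2)) <=
    mgf z c * exp (- (c * c / 2)) * exp (D / 2).
  move=> z1 D0 cdD c0.
  have eD : 1 <= exp (D / 2) by rewrite -exp_0; apply: exp_le; lra.
  have mc := mgf_gt0 c z1; have ec := exp_pos (- (c * c / 2)).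
  have [d0|d0] : 0 <= d \/ d < 0 by lra.
    have le1 : mgf z (c + d) * exp (- ((c + d) * (c + d) / 2)) <=
        mgf z c * exp (- (c * c / 2)) by apply: mgf_gauss_nonincr => //; lra.
    apply: Rle_trans le1 _; rewrite -[X in X <= _]Rmult_1_r.
    by apply: Rmult_le_compat_l => //; apply: Rmult_le_pos; lra.
  rewrite Rmult_assoc -exp_plus.
  have [cd|cd] : 0 <= c + d \/ c + d < 0 by lra.
    apply: Rmult_le_compat; [exact/Rlt_le/mgf_gt0 | exact/Rlt_le/exp_pos | |].
      by apply: mgf_nondecr => //; lra.
    by apply: exp_le; nra.
  apply: Rle_trans (mgf_le_gauss _ z1) _; rewrite -[X in X <= _]Rmult_1_r.
  apply: Rmult_le_compat; try lra; first exact: mgf_ge1.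
  by rewrite -exp_0; apply: exp_le; nra.
move=> y1 D0 abD.
have [a0|a0] : 0 <= a \/ 0 <= - a by lra.
  exact: pos.
have := pos (- y) (- a) (- b); rewrite -Ropp_plus_distr !mgf_sym.
rewrite (_ : - (a + b) * - (a + b) = (a + b) * (a + b)); last by ring.
rewrite (_ : - a * - a = a * a); last by ring.
by rewrite (_ : - a * - b = a * b); [apply; lra | ring].
Qed.

Definition walk_potential e a y : R := exp ((e - a * a) / 2) * mgf y a.

Lemma walk_potential_shift e a y : exists K, forall d,
  exp (d * a) * walk_potential e a (y + d) = walk_potential e a y + d * K.
Proof.
exists (exp ((e - a * a) / 2) * (exp (- (y * a)) * ((exp a - exp (- a)) / 2))) => d.
rewrite /walk_potential -Rmult_assoc (Rmult_comm (exp (d * a))) Rmult_assoc mgf_shift.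
ring.
Qed.

(** For the case where the pivot stays alive while other columns freeze. *)
Lemma walk_potential_transition e e' a a' y : -1 <= y <= 1 -> e' <= e ->
  - (2 * (a * (a' - a))) <= e - e' ->
  walk_potential e' a' y <= walk_potential e a y.
Proof.
move=> y1 ee aa; have D0 : 0 <= e - e' by lra.
have := mgf_transition y1 D0 aa; rewrite (_ : a + (a' - a) = a'); last by ring.
rewrite /walk_potential Rmult_assoc -exp_plus => H.
have E z b : exp ((z - b * b) / 2) * mgf y b = mgf y b * exp (- (b * b / 2)) * exp (z / 2).
  by rewrite Rmult_comm Rmult_assoc -exp_plus; congr (_ * exp _); field.
rewrite !E.
have -> : mgf y a * exp (- (a * a / 2)) * exp (e / 2) =
    mgf y a * exp (- (a * a / 2) + (e - e') / 2) * exp (e' / 2).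
  by rewrite !Rmult_assoc -!exp_plus; congr (_ * exp _); field.
by apply: Rmult_le_compat_r H; exact/Rlt_le/exp_pos.
Qed.

Lemma walk_potential_end e e' a y : y = 1 \/ y = -1 -> e' <= e - a * a ->
  exp (e' / 2) <= walk_potential e a y.
Proof.
by move=> y1 ee; rewrite /walk_potential mgf_end // Rmult_1_r; apply: exp_le; lra.
Qed.

Lemma walk_potential_start e a y : -1 <= y <= 1 -> walk_potential e a y <= exp (e / 2).
Proof.
move=> y1; rewrite /walk_potential (_ : (e - a * a) / 2 = - (a * a / 2) + e / 2); last by field.
rewrite exp_plus.
have -> : exp (- (a * a / 2)) * exp (e / 2) * mgf y a =
  mgf y a * exp (- (a * a / 2)) * exp (e / 2) by ring.
rewrite -[X in _ <= X]Rmult_1_l; apply: Rmult_le_compat_r; first exact/Rlt_le/exp_pos.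
exact: mgf_le_gauss.
Qed.

End Mgf.

From mathcomp Require Import ring lra zify.
Local Open Scope ring_scope.

(** * Minors and hereditary discrepancy *)

Section Lattice.
Variables (k : nat) (B : 'M[int]_k) (h : nat).
Hypothesis colourings : forall J : {set 'I_k}, exists e : 'I_k -> int,
  (forall j, e j = 1 \/ e j = -1) /\
  (forall i, `|\sum_(j in J) B i j * e j| <= h%:Z).

(** Adding the signs of a colouring to the odd coordinates makes [z] even and moves each entry of
    [B z] by at most [h]; halving and repeating [r] times costs [h (1 + 2 + ... + 2^(r-1))]. *)
Lemma dyadic_rounding r (z : 'cV[int]_k) : exists x : 'cV[int]_k,
  forall i, `|(B *m z) i 0 - 2 ^+ r * (B *m x) i 0| <= (2 ^+ r - 1) * h%:Z.
Proof.
elim: r z => [|r IH] z.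
  by exists z => i; rewrite expr0 mul1r !subrr normr0 mul0r.
pose J := [set j | modz (z j 0) 2 != 0].
have [e [e1 eJ]] := colourings J.
pose z' : 'cV[int]_k := \col_j divz (z j 0 + (if j \in J then e j else 0)) 2.
have z'E j : 2 * z' j 0 = z j 0 + (if j \in J then e j else 0).
  rewrite mxE inE; case: (eqVneq (modz (z j 0) 2) 0) => [ev|od] /=; first by lia.
  by case: (e1 j) => ->; lia.
have [x xP] := IH z'; exists x => i; have := xP i.
have -> : (B *m z) i 0 = 2 * (B *m z') i 0 - \sum_(j in J) B i j * e j.
  rewrite !mxE [X in _ - X]big_mkcond /= mulr_sumr -sumrB; apply: eq_bigr => j _.
  have -> : 2 * (B i j * z' j 0) = B i j * (2 * z' j 0) by ring.
  by rewrite z'E; case: ifP => _; ring.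
have := eJ i; move: (\sum_(j in J) _) ((B *m z') i 0) ((B *m x) i 0) => a b c.
rewrite exprS; move: (2 ^+ r) => t; rewrite !ler_norml; nia.
Qed.

Hypothesis entries : forall i j, `|B i j| <= 1.
Hypothesis det_neq0 : \det B != 0.

(** The rational solution of [B x = u], scaled by [2^k], is rounded to the integer vector [z], and
    then [z] to a multiple of [2^k]. *)
Lemma lattice_covering (u : 'cV[int]_k) : exists x : 'cV[int]_k,
  forall i, `|u i 0 - (B *m x) i 0| <= h%:Z.
Proof.
pose d := \det B; pose v := \adj B *m u.
have Bv : B *m v = d *: u by rewrite /v mulmxA mul_mx_adj mul_scalar_mx.
pose z : 'cV[int]_k := \col_j divz (2 ^+ k * v j 0) d.
pose rho : 'cV[int]_k := \col_j modz (2 ^+ k * v j 0) d.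
have vE : 2 ^+ k *: v = d *: z + rho.
  by apply/colP => j; rewrite !mxE [LHS](divz_eq _ d) mulrC.
have rho_le j : `|rho j 0| <= `|d|.
  by rewrite mxE ger0_norm ?modz_ge0 // ltW // ltz_mod.
have near i : `|2 ^+ k * u i 0 - (B *m z) i 0| <= k%:Z.
  have E : d * (2 ^+ k * u i 0 - (B *m z) i 0) = (B *m rho) i 0.
    have : B *m (2 ^+ k *: v) = B *m (d *: z + rho) by rewrite vE.
    rewrite mulmxDr -!scalemxAr Bv => /colP/(_ i); rewrite !mxE => E.
    by lra.
  have d0 : 0 < `|d| by rewrite normr_gt0.
  rewrite -(ler_pM2l d0) -normrM E mxE.
  apply: le_trans (ler_norm_sum _ _ _) _.
  apply: (@le_trans _ _ (\sum_(j < k) `|d|)); last by rewrite sumr_const card_ord; lia.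
  apply: ler_sum => j _; rewrite normrM -[X in _ <= X]mul1r.
  by apply: ler_pM; rewrite ?normr_ge0.
(* The errors add up to [k + (2^k - 1) h < 2^k (h + 1)]; after division by [2^k] the integer left is
   below [h + 1], hence at most [h]. *)
have [x xP] := dyadic_rounding k z; exists x => i.
have := xP i; have := near i.
have : (k < 2 ^ k)%N by exact: ltn_expl.
rewrite -natrX; move: (2 ^ k)%N => t.
move: (u i 0) ((B *m z) i 0) ((B *m x) i 0) => a b c kt; rewrite !ler_norml => H1 H2.
apply/andP; split; nia.
Qed.

(** [|det B|] is the index of the column lattice in [Z^k], and every coset meets the cube
    [[-h, h]^k], which has [(2 h + 1)^k] points. *)
Lemma det_le_covering : (`|\det B| <= (2 * h).+1 ^ k)%N.
Proof.
have [L uL [Q uQ [s _ BE]]] := int_Smith_normal_form B.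
pose sv (i : 'I_k) : int := s`_i.
pose D : 'M[int]_k := diag_mx (\row_i sv i).
have {}BE : B = L *m D *m Q.
  rewrite BE; congr (_ *m _ *m _); apply/matrixP => i j; rewrite !mxE.
  by rewrite -val_eqE.
have unit1 (M : 'M[int]_k) : M \in unitmx -> (`|\det M| = 1)%N.
  by rewrite unitmxE => /orP [] /eqP ->.
have detB : (`|\det B| = \prod_(i < k) `|sv i|)%N.
  rewrite BE !det_mulmx !abszM (unit1 L) // (unit1 Q) // mul1n muln1 det_diag.
  rewrite (big_morph absz abszM absz1); apply: eq_bigr => i _; by rewrite mxE.
have s0 (i : 'I_k) : sv i != 0.
  move: det_neq0; apply: contraNneq => si.
  by rewrite -absz_eq0 detB (bigD1 i) //= si.
(* By the Smith form [B = L D Q], the vectors [L c] with [0 <= c i < |sv i|] represent the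
   cosets. *)
pose T := fprod (fun i : 'I_k => 'I_(absz (sv i))).
pose vec (c : T) : 'cV[int]_k := L *m (\col_i (c i : nat)%:Z).
have [x xP] : exists x : T -> 'cV[int]_k, forall c i,
    `|vec c i 0 - (B *m x c) i 0| <= h%:Z.
  exact: (@fin_all_exists T _ (fun c x => forall i, `|vec c i 0 - (B *m x) i 0| <= h%:Z)
    (fun c => lattice_covering (vec c))).
pose val_ c i : int := vec c i 0 - (B *m x c) i 0.
(* The shift by [h] brings the coordinates into [0, ..., 2 h], so [inord] never takes its default
   value. *)
pose F (c : T) : {ffun 'I_k -> 'I_(2 * h).+1} :=
  [ffun i => inord (absz (val_ c i + h%:Z))].
have F_inj : injective F.
  move=> c c' /ffunP FF.
  have veq i : val_ c i = val_ c' i.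
    have := FF i; rewrite !ffunE => /(congr1 val) /=.
    have := xP c i; have := xP c' i; rewrite -/(val_ c i) -/(val_ c' i).
    by move: (val_ c i) (val_ c' i) => a b; rewrite !ler_norml => ? ?; rewrite !inordK; lia.
  apply/fprodP => i; apply: val_inj => /=.
  (* Equal images put the difference of [c] and [c'] in [D Z^k]; its entries are smaller than
     [|sv i|], so they vanish. *)
  have E : \col_i (c i : nat)%:Z - \col_i (c' i : nat)%:Z =
      D *m (Q *m (x c - x c')).
    apply: (can_inj (mulKmx uL)); rewrite !mulmxA -BE mulmxBr mulmxBr.
    have swap (a b a' b' : int) : a - b = a' - b' -> a - a' = b - b' by lia.
    by apply/colP => j; have := veq j; rewrite /val_ /vec !mxE; exact: swap.
  have /colP/(_ i) := E; rewrite mul_diag_mx !mxE.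
  move: (\sum_j _) => y cE; have := ltn_ord (c i); have := ltn_ord (c' i).
  have [y0|y0] := eqVneq y 0; first by move: cE; rewrite y0 mulr0; lia.
  have : (absz (sv i) <= absz (sv i) * absz y)%N by rewrite leq_pmulr // absz_gt0.
  by rewrite -abszM -cE; lia.
have := leq_card F F_inj; rewrite card_fprod card_ffun !card_ord detB.
by under eq_bigr do rewrite card_ord.
Qed.

End Lattice.

(** * Hereditary discrepancy and minors of incidence matrices *)

Section Herdisc.
Variable V : finType.
Implicit Types (F : {set {set V}}) (J S : {set V}) (x : {ffun V -> bool}).

Lemma set_disc_le_card x S : (set_disc x S <= #|V|)%N.
Proof.
rewrite /set_disc -lez_nat abszE; apply: le_trans (ler_norm_sum _ _ _) _.
apply: (@le_trans _ _ (\sum_(v in S) (1 : int))).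
  by apply: ler_sum => v _; rewrite /sgnc; case: (x v).
by rewrite sumr_const -[X in X <= _]/(_%:R) natz lez_nat max_card.
Qed.

Lemma disc_attained F : exists x, (col_disc F x <= disc F)%N.
Proof.
rewrite /disc; apply: (big_ind (fun n => exists x, (col_disc F x <= n)%N)).
- exists [ffun=> true]; apply/bigmax_leqP => S _; exact: set_disc_le_card.
- by move=> a b [x xa] [y yb]; rewrite /minn; case: ifP => _; [exists x | exists y].
- by move=> x _; exists x.
Qed.

Lemma disc_le F x : (disc F <= col_disc F x)%N.
Proof.
rewrite /disc; move: (mem_index_enum x); elim: (index_enum _) => // y s IH.
rewrite inE big_cons geq_min => /orP [/eqP ->|/IH ->]; by rewrite ?leqnn ?orbT.
Qed.

Lemma herdisc_colouring F J : exists x, forall S, S \in F ->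
  `|\sum_(v in S :&: J) sgnc x v| <= (herdisc F)%:Z.
Proof.
have [x xP] := disc_attained (restrict F J); exists x => S SF.
rewrite -abszE lez_nat -/(set_disc x (S :&: J)).
have le_disc : (disc (restrict F J) <= herdisc F)%N by exact: leq_bigmax.
apply: leq_trans le_disc; apply: leq_trans xP.
have SJ : S :&: J \in restrict F J by apply/imsetP; exists S.
by rewrite /col_disc (bigD1 (S :&: J)) //= leq_maxl.
Qed.

Lemma herdisc_le (R : numDomainType) F (r : R) : 0 <= r ->
  (forall J, exists x, forall S, S \in F ->
     (absz (\sum_(v in S :&: J) sgnc x v))%:R <= r) ->
  (herdisc F)%:R <= r.
Proof.
move=> r0 H; have maxP a b : a%:R <= r -> b%:R <= r -> (maxn a b)%:R <= r.
  by rewrite /maxn; case: ifP.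
apply: (big_ind (fun a => a%:R <= r)) => // J _; have [x xP] := H J.
apply: (@le_trans _ _ (col_disc (restrict F J) x)%:R); first by rewrite ler_nat disc_le.
by apply: (big_ind (fun a => a%:R <= r)) => // _ /imsetP [S SF ->]; exact: xP.
Qed.

(** A repeated column makes the determinant zero; otherwise sets of columns are subsets of [V], and
    colourings of the restrictions of [F] feed [det_le_covering]. *)
Lemma det_le_herdisc F k (S : 'I_k -> {set V}) (v : 'I_k -> V) :
  (forall i, S i \in F) -> (0 < herdisc F)%N ->
  `|\det (\matrix_(i, j) (v j \in S i)%:R : 'M[int]_k)| <= (3 * (herdisc F)%:Z) ^+ k.
Proof.
move=> SF h0; set B := \matrix_(i, j) _.
have [->|B0] := eqVneq (\det B) 0; first by rewrite normr0 exprn_ge0.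
have v_inj : injective v.
  move=> j j' vj; apply/eqP; apply: contraNT B0 => jj'; apply/eqP.
  rewrite -det_tr; apply: (determinant_alternate jj') => i.
  by rewrite !mxE vj.
have colourings (J : {set 'I_k}) : exists e : 'I_k -> int,
    (forall j, e j = 1 \/ e j = -1) /\
    (forall i, `|\sum_(j in J) B i j * e j| <= (herdisc F)%:Z).
  have [x xP] := herdisc_colouring F (v @: J).
  exists (fun j => sgnc x (v j)); split=> [j|i].
    by rewrite /sgnc; case: (x _); [left | right].
  rewrite (_ : \sum_(j in J) _ = \sum_(u in S i :&: v @: J) sgnc x u); first exact: xP.
  rewrite (eq_bigl (fun u => (u \in v @: J) && (u \in S i))); last first.
    by move=> u; rewrite inE andbC.
  rewrite big_mkcondr big_imset /=; last by move=> ? ? _ _; exact: v_inj.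
  by apply: eq_bigr => j _; rewrite mxE; case: ifP => _; rewrite ?mul1r ?mul0r.
have entries i j : `|B i j| <= 1 by rewrite mxE; case: (_ \in _).
have := det_le_covering colourings entries B0.
rewrite -lez_nat abszE => H; apply: le_trans H _.
rewrite -PoszM -[(3 * _)%:Z]natz -natrX natz lez_nat.
have [->|k0] := posnP k; first by rewrite !expn0.
(* [2 h + 1 <= 3 h] because [h > 0]. *)
by rewrite leq_exp2r //; lia.
Qed.

(** Restricted to one point [v] of [S], every colouring has sum 1 or -1. *)
Lemma herdisc_eq0 F S : herdisc F = 0%N -> S \in F -> S = set0.
Proof.
move=> h0 SF; apply/setP => v; rewrite inE; apply/negP => vS.
have [x /(_ S SF)] := herdisc_colouring F [set v].
by rewrite h0 (setIidPr _) ?sub1set // big_set1 /sgnc; case: (x v).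
Qed.

End Herdisc.

(** * Cauchy-Binet and the real spectral theorem *)

Lemma det_mul_expand (R : comPzRingType) k m (X : 'M[R]_(k, m)) (Y : 'M[R]_(m, k)) :
  \det (X *m Y) =
  \sum_(f : {ffun 'I_k -> 'I_m}) (\prod_i X i (f i)) * \det (rowsub f Y).
Proof.
transitivity (\sum_(s : 'S_k) \sum_(f : {ffun 'I_k -> 'I_m})
    (-1) ^+ s * \prod_i (X i (f i) * Y (f i) (s i))).
  apply: eq_bigr => s _; rewrite -big_distrr /=; congr (_ * _).
  rewrite -(bigA_distr_bigA (fun i j => X i j * Y j (s i))).
  by apply: eq_bigr => i _; rewrite mxE.
rewrite exchange_big; apply: eq_bigr => f _; rewrite big_distrr /=.
apply: eq_bigr => s _; rewrite big_split /= mulrCA.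
by congr (_ * (_ * _)); apply: eq_bigr => i _; rewrite mxE.
Qed.

(** The sum runs over all maps [f] instead of [k]-subsets: each subset occurs [k!] times, and maps
    that are not injective contribute 0. Relabelling [f] by every permutation [s] in
    [det_mul_expand] and summing over [s] assembles the minor of [X]. *)
Lemma Cauchy_Binet (R : comPzRingType) k m (X : 'M[R]_(k, m)) (Y : 'M[R]_(m, k)) :
  \det (X *m Y) *+ k`! =
  \sum_(f : {ffun 'I_k -> 'I_m}) \det (colsub f X) * \det (rowsub f Y).
Proof.
have permuted (s : 'S_k) : \det (X *m Y) =
    \sum_(f : {ffun 'I_k -> 'I_m})
      ((-1) ^+ s * \prod_i X i (f (s i))) * \det (rowsub f Y).
  rewrite det_mul_expand.
  pose hs (f : {ffun 'I_k -> 'I_m}) : {ffun 'I_k -> 'I_m} := [ffun i => f (s i)].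
  have hsb : bijective hs.
    exists (fun f : {ffun 'I_k -> 'I_m} => [ffun i => f ((s^-1)%g i)]) => f;
    by apply/ffunP => i; rewrite !ffunE ?permKV ?permK.
  rewrite (reindex hs) /=; last exact: onW_bij.
  apply: eq_bigr => f _.
  have -> : rowsub (hs f) Y = row_perm s (rowsub f Y).
    by apply/matrixP => i j; rewrite !mxE ffunE.
  rewrite row_permE det_mulmx det_perm mulrA [_ * (-1) ^+ s]mulrC; congr (_ * _ * _).
  by apply: eq_bigr => i _; rewrite ffunE.
rewrite -card_Sn -sumr_const.
rewrite (eq_bigr _ (fun s _ => permuted s)) exchange_big; apply: eq_bigr => f _.
rewrite -big_distrl /=; congr (_ * _).
by apply: eq_bigr => s _; congr (_ * _); apply: eq_bigr => i _; rewrite mxE.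
Qed.

(** * Inner products of row vectors *)

Section Dot.
Variable R : realFieldType.

Definition dot n (u v : 'rV[R]_n) : R := (u *m v^T) 0 0.

Lemma dotE n (u v : 'rV[R]_n) : dot u v = \sum_i u 0 i * v 0 i.
Proof. by rewrite /dot mxE; apply: eq_bigr => i _; rewrite mxE. Qed.

Lemma dotC n (u v : 'rV[R]_n) : dot u v = dot v u.
Proof. by rewrite !dotE; apply: eq_bigr => i _; rewrite mulrC. Qed.

Lemma dotDl n (u v w : 'rV[R]_n) : dot (u + v) w = dot u w + dot v w.
Proof. by rewrite /dot mulmxDl mxE. Qed.

Lemma dotDr n (u v w : 'rV[R]_n) : dot w (u + v) = dot w u + dot w v.
Proof. by rewrite dotC dotDl !(dotC w). Qed.

Lemma dotZl n a (u v : 'rV[R]_n) : dot (a *: u) v = a * dot u v.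
Proof. by rewrite /dot -scalemxAl mxE. Qed.

Lemma dotZr n a (u v : 'rV[R]_n) : dot u (a *: v) = a * dot u v.
Proof. by rewrite dotC dotZl dotC. Qed.

Lemma dotNl n (u v : 'rV[R]_n) : dot (- u) v = - dot u v.
Proof. by rewrite -scaleN1r dotZl mulN1r. Qed.

Lemma dotNr n (u v : 'rV[R]_n) : dot u (- v) = - dot u v.
Proof. by rewrite dotC dotNl dotC. Qed.

Lemma dot0l n (u : 'rV[R]_n) : dot 0 u = 0.
Proof. by rewrite -(scale0r 0) dotZl mul0r. Qed.

Lemma dot0r n (u : 'rV[R]_n) : dot u 0 = 0.
Proof. by rewrite dotC dot0l. Qed.

Lemma dot_suml n I r (P : pred I) (F : I -> 'rV[R]_n) v :
  dot (\sum_(i <- r | P i) F i) v = \sum_(i <- r | P i) dot (F i) v.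
Proof.
by apply: (big_morph (fun u => dot u v)); [move=> x y; rewrite dotDl | rewrite dot0l].
Qed.

Lemma dot_ge0 n (u : 'rV[R]_n) : 0 <= dot u u.
Proof. by rewrite dotE; apply: sumr_ge0 => i _; rewrite -expr2 sqr_ge0. Qed.

Lemma dot_eq0 n (u : 'rV[R]_n) : (dot u u == 0) = (u == 0).
Proof.
apply/eqP/eqP => [|->]; last exact: dot0l.
rewrite dotE => /eqP; rewrite psumr_eq0; last by move=> i _; rewrite -expr2 sqr_ge0.
move=> /allP u0; apply/rowP => i; rewrite mxE; apply/eqP.
by have := u0 i (mem_index_enum i); rewrite /= -expr2 sqrf_eq0.
Qed.

Lemma dot_mx n m (u : 'rV[R]_n) (A : 'M_(n, m)) v : dot (u *m A) v = dot u (v *m A^T).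
Proof. by rewrite /dot trmx_mul trmxK mulmxA. Qed.

Lemma Cauchy_Schwarz n (u v : 'rV[R]_n) : dot u v ^+ 2 <= dot u u * dot v v.
Proof.
have [->|v0] := eqVneq v 0; first by rewrite !dot0r mulr0 expr2 mulr0.
have vv : 0 < dot v v by rewrite lt_neqAle eq_sym dot_eq0 v0 dot_ge0.
have := dot_ge0 (dot v v *: u - dot u v *: v).
rewrite !(dotDl, dotDr, dotNl, dotNr, dotZl, dotZr) (dotC v u) => H.
have {H} : 0 <= dot v v * (dot u u * dot v v - dot u v ^+ 2) by nra.
by rewrite pmulr_rge0 // subr_ge0.
Qed.

Lemma sum_Cauchy_Schwarz (I : finType) (f g : I -> R) :
  (\sum_i f i * g i) ^+ 2 <= (\sum_i f i ^+ 2) * (\sum_i g i ^+ 2).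
Proof.
pose v (h : I -> R) : 'rV[R]_#|I| := \row_i h (enum_val i).
have E h k : dot (v h) (v k) = \sum_i h i * k i.
  rewrite dotE (reindex (@enum_val I I)) /=; last exact/onW_bij/enum_val_bij.
  by apply: eq_bigr => i _; rewrite !mxE.
by have := Cauchy_Schwarz (v f) (v g); rewrite !E.
Qed.

End Dot.

(** * Orthogonal diagonalization of real symmetric matrices *)

Section Spectral.
Variable R : rcfType.

(** A complex eigenvector [x + i y] exists. Symmetry gives [be (|x|^2 + |y|^2) = 0] for the
    imaginary part [be] of its eigenvalue, so whichever of [x] and [y] is nonzero is a real
    eigenvector. *)
Lemma sym_eigenvector n (A : 'M[R]_n.+1) : A^T = A ->
  exists a (u : 'rV_n.+1), u *m A = a *: u /\ dot u u = 1.
Proof.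
move=> symA.
suff [a [u [uA u0]]] : exists a (u : 'rV_n.+1), u *m A = a *: u /\ u != 0.
  have uu : 0 < dot u u by rewrite lt_neqAle eq_sym dot_eq0 u0 dot_ge0.
  exists a, ((Num.sqrt (dot u u))^-1 *: u).
  rewrite -scalemxAl uA !scalerA mulrC; split=> //.
  rewrite dotZl dotZr mulrA -expr2 exprVn sqr_sqrtr ?dot_ge0 // mulVf //.
  by rewrite gt_eqF.
pose toC := real_complex R.
have [|a /eigenvalueP [v vA v0]] := @eigenvalue_closed _ _ (map_mx toC A) => //.
pose x : 'rV[R]_n.+1 := \row_j complex.Re (v 0 j).
pose y : 'rV[R]_n.+1 := \row_j complex.Im (v 0 j).
have ReS (F : 'I_n.+1 -> R[i]) : complex.Re (\sum_j F j) = \sum_j complex.Re (F j).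
  by apply: (big_morph (@complex.Re R)) => // -[? ?] [? ?].
have ImS (F : 'I_n.+1 -> R[i]) : complex.Im (\sum_j F j) = \sum_j complex.Im (F j).
  by apply: (big_morph (@complex.Im R)) => // -[? ?] [? ?].
case: a vA => al be vA.
have xA : x *m A = al *: x - be *: y.
  apply/rowP => j; have /rowP/(_ j) := vA; rewrite !mxE => /(congr1 (@complex.Re R)).
  rewrite ReS => E; transitivity (complex.Re ((al +i* be)%C * v 0 j)).
    rewrite -E; apply: eq_bigr => k _; rewrite !mxE.
    by case: (v 0 k) => p q /=; ring.
  by case: (v 0 j) => p q /=.
have yA : y *m A = be *: x + al *: y.
  apply/rowP => j; have /rowP/(_ j) := vA; rewrite !mxE => /(congr1 (@complex.Im R)).
  rewrite ImS => E; transitivity (complex.Im ((al +i* be)%C * v 0 j)).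
    rewrite -E; apply: eq_bigr => k _; rewrite !mxE.
    by case: (v 0 k) => p q /=; ring.
  by case: (v 0 j) => p q /=; ring.
have xy0 : (x != 0) || (y != 0).
  rewrite -negb_and; apply: contra v0 => /andP [/eqP x0 /eqP y0].
  apply/eqP/rowP => j; move/rowP/(_ j): x0; move/rowP/(_ j): y0; rewrite !mxE.
  by case: (v 0 j) => p q /= -> ->.
have be0 : be = 0.
  have : dot (x *m A) y = dot x (y *m A) by rewrite dot_mx symA.
  rewrite xA yA !(dotDl, dotDr, dotNl, dotZl, dotZr) => H.
  have {}H : be * (dot x x + dot y y) = 0 by lra.
  apply/eqP; move/eqP: H; rewrite mulf_eq0 => /orP [//|].
  by rewrite paddr_eq0 ?dot_ge0 // !dot_eq0 -[_ && _]negbK negb_and xy0.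
case/orP: xy0 => nz; [exists al, x | exists al, y];
  by rewrite ?xA ?yA be0 scale0r ?subr0 ?add0r.
Qed.

(* The Householder reflection exchanging [u] and the first basis vector. *)
Lemma orthogonal_extension n (u : 'rV[R]_(1 + n)) : dot u u = 1 ->
  exists H : 'M[R]_(1 + n), H *m H^T = 1%:M /\ row 0 H = u.
Proof.
move=> u1; pose e : 'rV[R]_(1 + n) := delta_mx 0 0.
have e1 : dot e e = 1.
  rewrite dotE (bigD1 0) //= big1 ?addr0; last by move=> i i0; rewrite !mxE (negbTE i0) mul0r.
  by rewrite !mxE eqxx mulr1.
have [->|ue] := eqVneq u e.
  exists 1%:M; rewrite trmx1 mulmx1; split=> //; apply/rowP => j.
  by rewrite !mxE eqxx eq_sym.
have [w wE] : exists w, w = u - e by exists (u - e).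
pose q := dot w w.
have q0 : q != 0 by rewrite dot_eq0 wE subr_eq0.
have qE : q = 2 - 2 * dot u e.
  by rewrite /q wE !(dotDl, dotDr, dotNl, dotNr) u1 e1 (dotC e u); ring.
pose H : 'M[R]_(1 + n) := 1%:M - (2 / q) *: (w^T *m w).
have Hsym : H^T = H by rewrite /H linearB linearZ /= trmx1 trmx_mul trmxK.
have ww : w *m w^T = q%:M.
  by apply/matrixP => i j; rewrite !ord1 [RHS]mxE eqxx.
exists H; rewrite Hsym; split.
  have wwww : (w^T *m w) *m (w^T *m w) = q *: (w^T *m w).
    by rewrite mulmxA -(mulmxA w^T) ww mul_mx_scalar -scalemxAl.
  rewrite /H mulmxBl mul1mx mulmxBr mulmx1 -scalemxAl -scalemxAr wwww !scalerA.
  have -> : 2 / q * (2 / q) * q = 2 / q + 2 / q by field.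
  by rewrite scalerDl opprB addrK subrK.
rewrite rowE -/e mulmxBr mulmx1 -scalemxAr mulmxA.
have -> : e *m w^T = (dot e w)%:M.
  by apply/matrixP => i j; rewrite !ord1 [RHS]mxE eqxx.
have -> : dot e w = - q / 2.
  by rewrite wE dotDr dotNr e1 (dotC e) qE; field.
rewrite mul_scalar_mx scalerA.
have -> : 2 / q * (- q / 2) = -1 by field.
by rewrite scaleN1r opprK wE addrCA subrr addr0.
Qed.

Lemma real_spectral n (A : 'M[R]_n) : A^T = A ->
  exists (P : 'M[R]_n) (d : 'rV_n), P *m P^T = 1%:M /\ P *m A *m P^T = diag_mx d.
Proof.
elim: n A => [|n IH] A symA.
  by exists 1%:M, 0; split; apply/matrixP => -[].
have [a [u [uA u1]]] := sym_eigenvector symA.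
have [H [HH Hu]] := @orthogonal_extension n u u1.
have [A' A'E] : exists A' : 'M[R]_(1 + n), A' = H *m A *m H^T by eexists.
have symA' : A'^T = A' by rewrite A'E !trmx_mul trmxK symA mulmxA.
have row0 : row 0 A' = a *: delta_mx 0 0.
  rewrite A'E !row_mul Hu uA -scalemxAl -Hu -row_mul HH; congr (_ *: _).
  by apply/rowP => j; rewrite !mxE eqxx eq_sym.
have entry0 j : A' 0 j = a * (j == 0)%:R.
  by have /rowP/(_ j) := row0; rewrite !mxE.
have [P [d [PP PAP]]] : exists (P : 'M[R]_n) (d : 'rV_n), P *m P^T = 1%:M /\
    P *m drsubmx A' *m P^T = diag_mx d.
  by apply: IH; rewrite trmx_drsub symA'.
have blockA' : A' = block_mx a%:M 0 0 (drsubmx A').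
  rewrite -[LHS]submxK; congr block_mx; apply/matrixP => i j; rewrite !mxE.
  - by rewrite !ord1 !lshift0 entry0 eqxx mulr1.
  - by rewrite ord1 lshift0 entry0 -val_eqE /= mulr0.
  - have -> : A' (rshift 1 i) (lshift n j) = A'^T (lshift n j) (rshift 1 i) by rewrite mxE.
    by rewrite symA' ord1 lshift0 entry0 -val_eqE /= mulr0.
pose Q : 'M[R]_(1 + n) := block_mx 1%:M 0 0 P.
have QT : Q^T = block_mx 1%:M 0 0 P^T by rewrite tr_block_mx !trmx0 trmx1.
suff: exists (P : 'M[R]_(1 + n)) (d : 'rV_(1 + n)), P *m P^T = 1%:M /\
    P *m (A : 'M_(1 + n)) *m P^T = diag_mx d by [].
exists (Q *m H), (row_mx a%:M d); rewrite trmx_mul; split.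
  rewrite mulmxA -(mulmxA Q) HH mulmx1 QT /Q mulmx_block !mulmx0 !mul0mx !mulmx1 PP.
  by rewrite !addr0 !add0r -scalar_mx_block.
rewrite !mulmxA -(mulmxA Q) -(mulmxA Q) -A'E blockA' QT /Q.
rewrite !mulmx_block !(mulmx0, mul0mx, mulmx1, mul1mx, addr0, add0r) PAP.
rewrite diag_mx_row; congr block_mx.
by apply/matrixP => i j; rewrite !ord1 !mxE eqxx.
Qed.

End Spectral.

(** * From minors to factorizations *)

(** [k^k <= (2 k)! / k!], which is a central binomial coefficient times [k!]. *)
Lemma expnn_le_fact k : (k ^ k <= 4 ^ k * k`!)%N.
Proof.
have bin_le : ('C(k + k, k) <= 4 ^ k)%N.
  rewrite (_ : 4 ^ k = 2 ^ (k + k))%N; last by rewrite addnn -mul2n expnM.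
  rewrite -[2%N]/(1 + 1)%N Pascal (bigD1 (inord k)) //= !exp1n !muln1.
  by rewrite inordK ?leq_addr // ltnS leq_addr.
apply: leq_trans (leq_mul bin_le (leqnn _)).
rewrite bin_ffact ffact_prod (_ : k ^ k = \prod_(i < k) k)%N;
  last by rewrite prod_nat_const card_ord.
by apply: leq_prod => i _; have := ltn_ord i; lia.
Qed.

(** Induction removing the least value [s]: among [n] elements it satisfies [s^n n! <= c^n], hence
    [s <= 4 c / n] by [expnn_le_fact]. *)
Lemma sum_le_harmonic (R : realFieldType) (T : finType) (s : T -> R) (c : R) :
  0 <= c -> (forall i, 0 <= s i) ->
  (forall K : {set T}, (\prod_(i in K) s i) * (#|K|`!)%:R <= c ^+ #|K|) ->
  \sum_i s i <= 4 * c * \sum_(i < #|T|) i.+1%:R^-1.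
Proof.
move=> c0 s0 prod_le.
suff H n (K : {set T}) : #|K| = n ->
    \sum_(i in K) s i <= 4 * c * \sum_(i < n) i.+1%:R^-1.
  by have := H _ setT (cardsT T); under eq_bigl do rewrite in_setT.
elim: n K => [|n IH] K cK.
  by rewrite (cards0_eq cK) big_set0 big_ord0 mulr0.
have /card_gt0P [i0 i0K] : (0 < #|K|)%N by rewrite cK.
have [i iK imin] : exists2 i, i \in K & {in K, forall j, s i <= s j}.
  by case: (arg_minP s i0K) => i; exists i.
rewrite (big_setD1 i) //= big_ord_recr /= mulrDr addrC.
apply: lerD; first by apply: IH; move: cK; rewrite (cardsD1 i) iK => -[].
rewrite ler_pdivlMr ?ltr0Sn //.
have := prod_le K; rewrite cK => le1.
have le2 : s i ^+ n.+1 <= \prod_(i in K) s i.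
  rewrite -cK -prodr_const; apply: ler_prod => j jK; rewrite s0 /=; exact: imin.
have c40 : 0 <= 4 * c by lra.
rewrite -(@ler_pXn2r _ n.+1) ?nnegrE ?mulr_ge0 ?ler0n // exprMn exprMn.
apply: le_trans (ler_wpM2l (exprn_ge0 _ (ler0n _ 4)) le1).
have := expnn_le_fact n.+1; rewrite -(ler_nat R) natrM !natrX => le3.
apply: le_trans (ler_wpM2l (exprn_ge0 _ (s0 i)) le3) _.
rewrite mulrCA; apply: ler_wpM2l; first by rewrite exprn_ge0.
by apply: ler_wpM2r; rewrite ?ler0n.
Qed.

(** * Singular values, minors and the trace norm *)

Section TraceNorm.
Variable R : rcfType.

(** [d] holds the squared singular values of [M]. By Cauchy-Binet their product over [K], times
    [k!], is the sum of the squared minors of [P M] in the rows [K]. These expand in minors of [P]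
    and [M], and Cauchy-Schwarz applies, as the squared minors of [P] sum to [k!]. *)
Lemma prod_spectral_le m n (M : 'M[R]_(m, n)) (P : 'M_m) (d : 'rV_m) (K : {set 'I_m}) :
  P *m P^T = 1%:M -> (P *m M) *m (P *m M)^T = diag_mx d ->
  (\prod_(i in K) d 0 i) * (#|K|`!)%:R ^+ 2 <=
  \sum_(f : {ffun 'I_#|K| -> 'I_m}) \sum_(g : {ffun 'I_#|K| -> 'I_n})
     \det (mxsub f g M) ^+ 2.
Proof.
move=> PP; set N := P *m M => NN; set k := #|K|.
pose ka := @enum_val _ (mem K) : 'I_k -> 'I_m.
have ka_inj : injective ka by exact: enum_val_inj.
have gram_det l (X : 'M[R]_(m, l)) :
   \sum_(f : {ffun 'I_k -> 'I_l}) \det (mxsub ka f X) ^+ 2 =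
   \det (mxsub ka ka (X *m X^T)) *+ k`!.
  have -> : mxsub ka ka (X *m X^T) = rowsub ka X *m (rowsub ka X)^T.
    by apply/matrixP => i j; rewrite !mxE; apply: eq_bigr => h _; rewrite !mxE.
  rewrite Cauchy_Binet; apply: eq_bigr => f _; rewrite expr2.
  congr (_ * _); first by congr (\det _); apply/matrixP => i j; rewrite !mxE.
  by rewrite -det_tr; congr (\det _); apply/matrixP => i j; rewrite !mxE.
have detP : \sum_(f : {ffun 'I_k -> 'I_m}) \det (mxsub ka f P) ^+ 2 = k`!%:R.
  rewrite gram_det PP (_ : mxsub _ _ _ = 1%:M) ?det1 //.
  by apply/matrixP => i j; rewrite !mxE (inj_eq ka_inj).
have detN : \sum_(g : {ffun 'I_k -> 'I_n}) \det (mxsub ka g N) ^+ 2 =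
    (\prod_(i in K) d 0 i) * k`!%:R.
  rewrite gram_det NN (_ : mxsub _ _ _ = diag_mx (\row_i d 0 (ka i))).
    rewrite det_diag -[LHS]mulr_natr; congr (_ * _).
    rewrite [RHS]big_enum_val /=.
    by apply: eq_bigr => i _; rewrite mxE.
  by apply/matrixP => i j; rewrite !mxE (inj_eq ka_inj).
rewrite expr2 mulrA -detN mulr_suml exchange_big /=; apply: ler_sum => g _.
have CB : \det (mxsub ka g N) * k`!%:R = \sum_(f : {ffun 'I_k -> 'I_m})
    \det (mxsub ka f P) * \det (mxsub f g M).
  have -> : mxsub ka g N = rowsub ka P *m colsub g M.
    by apply/matrixP => i j; rewrite !mxE; apply: eq_bigr => h _; rewrite !mxE.
  rewrite mulr_natr Cauchy_Binet; apply: eq_bigr => f _.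
  by congr (_ * _); congr (\det _); apply/matrixP => i j; rewrite !mxE.
have := sum_Cauchy_Schwarz (fun f : {ffun 'I_k -> 'I_m} => \det (mxsub ka f P))
  (fun f => \det (mxsub f g M)).
rewrite -CB detP exprMn expr2 [k`!%:R ^+ 2]expr2 mulrA mulrC ler_pM2l //.
by rewrite ltr0n fact_gt0.
Qed.

Lemma trace_factorization m n (M : 'M[R]_(m, n)) (c : R) : 0 <= c ->
  (forall k, \sum_(f : {ffun 'I_k -> 'I_m}) \sum_(g : {ffun 'I_k -> 'I_n})
     \det (mxsub f g M) ^+ 2 <= (c ^+ k) ^+ 2) ->
  let t := 4 * c * \sum_(i < m) i.+1%:R^-1 in
  exists (B : 'M[R]_m) (C : 'M[R]_(m, n)),
    [/\ M = B *m C, \sum_i \sum_k B i k ^+ 2 <= t & \sum_j \sum_k C k j ^+ 2 <= t].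
Proof.
move=> c0 minors t.
have [P [d [PP PMP]]] : exists (P : 'M[R]_m) (d : 'rV_m), P *m P^T = 1%:M /\
    P *m (M *m M^T) *m P^T = diag_mx d.
  by apply: (@real_spectral R m (M *m M^T)); rewrite trmx_mul trmxK.
have [N NE] : exists N, N = P *m M by eexists.
have NN : N *m N^T = diag_mx d by rewrite NE trmx_mul !mulmxA in PMP *.
have NNE k : \sum_j N k j ^+ 2 = d 0 k.
  have /matrixP/(_ k k) := NN; rewrite !mxE eqxx mulr1n => <-.
  by apply: eq_bigr => j _; rewrite mxE.
have d0 k : 0 <= d 0 k by rewrite -NNE; apply: sumr_ge0 => j _; exact: sqr_ge0.
have PTP : P^T *m P = 1%:M by apply: mulmx1C.
pose s k := Num.sqrt (d 0 k).
have s0 k : 0 <= s k by exact: sqrtr_ge0.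
have sum_s : \sum_k s k <= t.
  have := @sum_le_harmonic R _ s c c0 s0; rewrite card_ord; apply=> K.
  rewrite -(@ler_pXn2r _ 2) ?nnegrE ?exprn_ge0 ?mulr_ge0 ?ler0n ?prodr_ge0 //.
  apply: le_trans (minors #|K|); rewrite NE in NN; apply: le_trans (prod_spectral_le K PP NN).
  rewrite exprMn -prodrXl; apply: ler_wpM2r; first by rewrite exprn_ge0 ?ler0n.
  by apply: ler_prod => i _; rewrite sqr_ge0 sqr_sqrtr /=.
(* The singular value [s k] is shared equally: each factor gets [q k] in direction [k], so both have
   the trace norm as squared Frobenius norm. *)
pose q k := Num.sqrt (s k).
have q2 k : q k ^+ 2 = s k by rewrite sqr_sqrtr.
(* If [q k] vanishes, so does row [k] of [N], and the convention [0^-1 = 0] does no harm below. *)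
have N0 k j : q k = 0 -> N k j = 0.
  move=> qk; have := NNE k.
  have -> : d 0 k = 0.
    have := q2 k; rewrite qk expr0n /= => /esym sk.
    by have := sqr_sqrtr (d0 k); rewrite -/(s k) sk expr0n.
  move/eqP; rewrite psumr_eq0; last by move=> *; exact: sqr_ge0.
  by move/allP/(_ j (mem_index_enum j)); rewrite sqrf_eq0 => /eqP.
exists (\matrix_(i, k) (P k i * q k)), (\matrix_(k, j) ((q k)^-1 * N k j)); split.
- rewrite -[M]mul1mx -PTP -mulmxA -NE; apply/matrixP => i j; rewrite !mxE.
  apply: eq_bigr => k _; rewrite !mxE.
  have [qk|qk] := eqVneq (q k) 0; first by rewrite N0 // !mulr0.
  by rewrite mulrA mulfK.
- rewrite exchange_big; apply: le_trans sum_s; apply: ler_sum => k _ /=.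
  under eq_bigr do rewrite mxE exprMn q2.
  rewrite -mulr_suml (_ : \sum_i _ = 1) ?mul1r //.
  have /matrixP/(_ k k) := PP; rewrite !mxE eqxx -[true%:R]/1 => <-.
  by apply: eq_bigr => j _; rewrite mxE expr2.
- rewrite exchange_big; apply: le_trans sum_s; apply: ler_sum => k _ /=.
  under eq_bigr do rewrite mxE exprMn exprVn q2.
  rewrite -mulr_sumr NNE -(sqr_sqrtr (d0 k)) -/(s k).
  have [->|sk] := eqVneq (s k) 0; first by rewrite expr0n mulr0.
  by rewrite expr2 mulKf.
Qed.

End TraceNorm.

(* Gradient descent on [\sum_i max (x i - r) 0 ^ 2]. *)
Lemma finite_minimax (R : archiRealFieldType) (I : finType) (K : (I -> R) -> Prop)
    (M r r' : R) :
  (forall x y l, K x -> K y -> 0 <= l <= 1 ->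
     K (fun i => (1 - l) * x i + l * y i)) ->
  (0 < #|I|)%N -> r < r' ->
  (forall w : I -> R, (forall i, 0 <= w i) -> \sum_i w i = 1 ->
     exists x, [/\ K x, forall i, 0 <= x i <= M & \sum_i w i * x i <= r]) ->
  exists2 x, K x & forall i, x i <= r'.
Proof.
move=> Kconv I0 rr' Kw.
pose pos (a : R) := Num.max a 0.
have pos0 a : 0 <= pos a by rewrite le_max lexx orbT.
have posM a : pos a * a = pos a ^+ 2.
  by rewrite /pos; case: (leP a 0) => _; rewrite ?expr0n ?mul0r ?expr2.
have posD a b : pos (a + b) ^+ 2 <= pos a ^+ 2 + 2 * pos a * b + b ^+ 2.
  by rewrite /pos; case: (leP (a + b) 0) => h1; case: (leP a 0) => h2; nra.
pose f (x : I -> R) := \sum_i pos (x i - r) ^+ 2.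
pose eps := (r' - r) ^+ 2; have eps0 : 0 < eps by rewrite exprn_gt0 ?subr_gt0.
pose Q := #|I|%:R * M ^+ 2; have Q0 : 0 <= Q by rewrite mulr_ge0 ?ler0n ?sqr_ge0.
(* With this step length the second order term [l^2 Q] is at most [l eps], so a step from
   [f x > eps] lowers [f] by at least [l eps]. *)
pose l := eps / (Q + eps).
have Qe0 : 0 < Q + eps by lra.
have l0 : 0 < l by rewrite divr_gt0.
have l1 : l <= 1 by rewrite ler_pdivrMr //; lra.
have lQ : l * Q <= eps.
  by rewrite /l mulrAC ler_pdivrMr //; apply: ler_wpM2l; lra.
have descent n x : K x -> (forall i, 0 <= x i <= M) ->
    f x <= eps + n%:R * (l * eps) -> exists2 x, K x & forall i, x i <= r'.
  elim: n x => [|n IH] x Kx xM fx.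
    exists x => // i; rewrite mul0r addr0 in fx.
    have : pos (x i - r) ^+ 2 <= (r' - r) ^+ 2.
      apply: le_trans fx; rewrite /f (bigD1 i) //= lerDl.
      by apply: sumr_ge0 => j _; rewrite sqr_ge0.
    rewrite ler_pXn2r ?nnegrE //; last by lra.
    by rewrite ge_max => /andP [+ _]; lra.
  have [fle|flt] := leP (f x) eps.
    by apply: (IH x) => //; apply: le_trans fle _; rewrite lerDl mulr_ge0 ?ler0n // ltW // mulr_gt0.
  pose S := \sum_i pos (x i - r).
  have S0 : 0 < S.
    rewrite lt_neqAle eq_sym sumr_ge0 ?andbT //; apply: contraTneq flt => S0.
    rewrite -leNgt /f big1 ?(ltW eps0) // => i _.
    move/eqP: S0; rewrite psumr_eq0 // => /allP/(_ i (mem_index_enum i))/eqP ->.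
    by rewrite expr0n.
  (* The weights are proportional to the gradient of [f] at [x], which makes [y - x] a descent
     direction. *)
  have [||y [Ky yM yr]] := Kw (fun i => pos (x i - r) / S).
  - by move=> i; rewrite divr_ge0 // ltW.
  - by rewrite -mulr_suml divff // gt_eqF.
  apply: (IH (fun i => (1 - l) * x i + l * y i)).
  - by apply: Kconv => //; rewrite l1 ltW.
  - by move=> i; have /andP [? ?] := xM i; have /andP [? ?] := yM i; apply/andP; split; nra.
  have yS : \sum_i pos (x i - r) * y i <= S * r.
    move: yr; under eq_bigr do rewrite mulrAC.
    by rewrite -mulr_suml ler_pdivrMr // mulrC.
  have grad : \sum_i pos (x i - r) * (y i - x i) <= - f x.
    have -> : \sum_i pos (x i - r) * (y i - x i) =
        \sum_i pos (x i - r) * y i - S * r - f x.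
      rewrite /S mulr_suml /f -!sumrB; apply: eq_bigr => i _.
      by rewrite -posM; ring.
    lra.
  have step : f (fun i => (1 - l) * x i + l * y i) <=
      f x + 2 * l * (\sum_i pos (x i - r) * (y i - x i)) + l * (l * Q).
    have -> : Q = \sum_(i : I) M ^+ 2 by rewrite sumr_const /Q mulr_natl.
    rewrite /f !mulr_sumr -!big_split /=; apply: ler_sum => i _.
    have -> : (1 - l) * x i + l * y i - r = (x i - r) + l * (y i - x i) by ring.
    apply: le_trans (posD _ _) _.
    have /andP [? ?] := xM i; have /andP [? ?] := yM i.
    have d2 : (y i - x i) ^+ 2 <= M ^+ 2 by nra.
    have : l ^+ 2 * (y i - x i) ^+ 2 <= l ^+ 2 * M ^+ 2 by rewrite ler_wpM2l ?sqr_ge0.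
    by move: (pos _) => p H; lra.
  apply: le_trans step _; rewrite -natr1 mulrDl mul1r in fx.
  have : l * (l * Q) <= l * eps by rewrite ler_wpM2l // ltW.
  have : l * (\sum_i pos (x i - r) * (y i - x i)) <= l * - f x by rewrite ler_wpM2l // ltW.
  have : l * eps <= l * f x by rewrite ler_wpM2l // ltW.
  lra.
have cI : #|I|%:R != 0 :> R by rewrite pnatr_eq0 -lt0n.
have [||x [Kx xM _]] := Kw (fun=> #|I|%:R^-1).
- by move=> i; rewrite invr_ge0 ler0n.
- by rewrite sumr_const -[LHS]mulr_natl divff.
have le0 : 0 < l * eps by rewrite mulr_gt0.
have fx0 : 0 <= f x / (l * eps) by rewrite divr_ge0 ?(ltW le0) // sumr_ge0 // => *; exact: sqr_ge0.
apply: (descent (Num.bound (f x / (l * eps))) x) => //.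
have := archi_boundP fx0; rewrite ltr_pdivrMr //; lra.
Qed.

(** * Factorizations with bounded rows and columns *)

Section Factorization.
Variable R : archiRcfType.

(** The bounds on rows and columns form one vector [x] and the inner dimension is free, which makes
    the attainable vectors a convex set, as [finite_minimax] requires. *)
Definition factorizable m n (A : 'M[R]_(m, n)) (x : 'I_m + 'I_n -> R) :=
  exists N (B : 'M[R]_(m, N)) (C : 'M[R]_(N, n)),
    [/\ A = B *m C, forall i, \sum_k B i k ^+ 2 <= x (inl i) &
        forall j, \sum_k C k j ^+ 2 <= x (inr j)].

Lemma factorizable_convex m n (A : 'M[R]_(m, n)) x y l :
  factorizable A x -> factorizable A y -> 0 <= l <= 1 ->
  factorizable A (fun i => (1 - l) * x i + l * y i).
Proof.
move=> [N [B [C [AE Bx Cx]]]] [N' [B' [C' [AE' By Cy]]]] /andP [l0 l1].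
have l1' : 0 <= 1 - l by lra.
exists (N + N')%N, (row_mx (Num.sqrt (1 - l) *: B) (Num.sqrt l *: B')),
  (col_mx (Num.sqrt (1 - l) *: C) (Num.sqrt l *: C')); split.
- rewrite mul_row_col -!scalemxAl -!scalemxAr !scalerA -!expr2 !sqr_sqrtr //.
  by rewrite -AE -AE' -scalerDl subrK scale1r.
- move=> i; rewrite big_split_ord /=; apply: lerD.
    under eq_bigr do rewrite row_mxEl mxE exprMn sqr_sqrtr //.
    by rewrite -mulr_sumr ler_wpM2l.
  under eq_bigr do rewrite row_mxEr mxE exprMn sqr_sqrtr //.
  by rewrite -mulr_sumr ler_wpM2l.
- move=> i; rewrite big_split_ord /=; apply: lerD.
    under eq_bigr do rewrite col_mxEu mxE exprMn sqr_sqrtr //.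
    by rewrite -mulr_sumr ler_wpM2l.
  under eq_bigr do rewrite col_mxEd mxE exprMn sqr_sqrtr //.
  by rewrite -mulr_sumr ler_wpM2l.
Qed.

(** [trace_factorization] is applied to [A] with rows scaled by [sqrt (p i)] and columns by
    [sqrt (q j)]; undoing the scaling turns Frobenius norms into weighted sums of squared
    lengths. *)
Lemma weighted_factorization m n (A : 'M[R]_(m, n)) (c : R)
    (p : 'I_m -> R) (q : 'I_n -> R) : 0 <= c ->
  (forall k (f : 'I_k -> 'I_m) (g : 'I_k -> 'I_n),
     `|\det (mxsub f g A)| <= c ^+ k) ->
  (forall i, 0 < p i) -> (forall j, 0 < q j) -> \sum_i p i + \sum_j q j = 2 ->
  exists x, [/\ factorizable A x, forall i, 0 <= x i &
    \sum_i p i * x (inl i) + \sum_j q j * x (inr j) <=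
      8 * c * \sum_(i < m) i.+1%:R^-1].
Proof.
move=> c0 minors p0 q0 pq.
pose M := \matrix_(i, j) (Num.sqrt (p i) * A i j * Num.sqrt (q j)).
have sp i : Num.sqrt (p i) != 0 by rewrite gt_eqF // sqrtr_gt0.
have sq i : Num.sqrt (q i) != 0 by rewrite gt_eqF // sqrtr_gt0.
have sp2 i : Num.sqrt (p i) ^+ 2 = p i by rewrite sqr_sqrtr // ltW.
have sq2 i : Num.sqrt (q i) ^+ 2 = q i by rewrite sqr_sqrtr // ltW.
(* Scaling multiplies the squared minors by products of weights; these sum over [f] and [g] to
   [((\sum p) (\sum q))^k], at most 1 by AM-GM. *)
have Mminors k : \sum_(f : {ffun 'I_k -> 'I_m}) \sum_(g : {ffun 'I_k -> 'I_n})
    \det (mxsub f g M) ^+ 2 <= (c ^+ k) ^+ 2.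
  have sum_pow l (w : 'I_l -> R) :
      \sum_(f : {ffun 'I_k -> 'I_l}) \prod_i w (f i) = (\sum_i w i) ^+ k.
    by rewrite -(bigA_distr_bigA (fun _ j => w j)) prodr_const card_ord.
  have : \sum_(f : {ffun 'I_k -> 'I_m}) \sum_(g : {ffun 'I_k -> 'I_n})
      ((\prod_i p (f i)) * (\prod_i q (g i))) * (c ^+ k) ^+ 2 <= (c ^+ k) ^+ 2.
    under eq_bigr do rewrite -mulr_suml -mulr_sumr.
    rewrite -!mulr_suml !sum_pow -exprMn ler_piMl ?sqr_ge0 //.
    have ? : 0 <= \sum_i p i by apply: sumr_ge0 => i _; exact: ltW.
    have ? : 0 <= \sum_j q j by apply: sumr_ge0 => i _; exact: ltW.
    rewrite exprn_ile1 ?mulr_ge0 //.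
    move: (\sum_i p i) (\sum_j q j) pq => P Q PQ.
    have -> : Q = 2 - P by lra.
    have := sqr_ge0 (1 - P); lra.
  apply: le_trans; apply: ler_sum => f _; apply: ler_sum => g _.
  have -> : mxsub f g M = diag_mx (\row_i Num.sqrt (p (f i))) *m mxsub f g A *m
      diag_mx (\row_j Num.sqrt (q (g j))).
    by rewrite mul_diag_mx mul_mx_diag; apply/matrixP => i j; rewrite !mxE.
  rewrite !det_mulmx !det_diag mulrAC exprMn.
  have -> : ((\prod_i (\row_i0 Num.sqrt (p (f i0))) 0 i) *
      (\prod_i (\row_j Num.sqrt (q (g j))) 0 i)) ^+ 2 =
      (\prod_i p (f i)) * (\prod_i q (g i)) :> R.
    by rewrite exprMn -!prodrXl; congr (_ * _); apply: eq_bigr => i _; rewrite mxE.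
  apply: ler_wpM2l; first by rewrite mulr_ge0 // prodr_ge0 // => i _; exact: ltW.
  by rewrite -real_normK ?num_real // ler_pXn2r ?nnegrE ?exprn_ge0.
have [B [C [MBC Bt Ct]]] := trace_factorization c0 Mminors.
exists (fun i => match i with
  | inl i => (\sum_k B i k ^+ 2) / p i | inr j => (\sum_k C k j ^+ 2) / q j end); split.
- exists m, (\matrix_(i, k) (B i k / Num.sqrt (p i))),
    (\matrix_(k, j) (C k j / Num.sqrt (q j))); split.
  + apply/matrixP => i j; have /matrixP/(_ i j) := MBC; rewrite !mxE => E.
    apply: (mulfI (sp i)); apply: (mulIf (sq j)); rewrite E mulr_sumr mulr_suml.
    by apply: eq_bigr => k _; rewrite !mxE; field; rewrite sp sq.
  + move=> i; rewrite mulr_suml; apply: ler_sum => k _.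
    by rewrite mxE exprMn exprVn sp2.
  + move=> j; rewrite mulr_suml; apply: ler_sum => k _.
    by rewrite mxE exprMn exprVn sq2.
- by move=> [i|j]; rewrite divr_ge0 ?(ltW (p0 _)) ?(ltW (q0 _)) // sumr_ge0 // => *;
    exact: sqr_ge0.
under eq_bigr do rewrite mulrC divfK ?gt_eqF //.
under [X in _ + X]eq_bigr do rewrite mulrC divfK ?gt_eqF //.
by apply: le_trans (lerD Bt Ct) _; lra.
Qed.

Lemma minors_factorization m n (A : 'M[R]_(m, n)) (c : R) : 0 < c -> (0 < m)%N ->
  (forall k (f : 'I_k -> 'I_m) (g : 'I_k -> 'I_n),
     `|\det (mxsub f g A)| <= c ^+ k) ->
  factorizable A (fun=> 12 * c * \sum_(i < m) i.+1%:R^-1).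
Proof.
move=> c0 m0 minors; set h := \sum_(i < m) _.
have h0 : 0 < h.
  rewrite /h (bigD1 (Ordinal m0)) //= ltr_pwDl ?invr_gt0 ?ltr0Sn //.
  by apply: sumr_ge0 => i _; rewrite invr_ge0 ler0n.
have mn0 : (0 < #|{: 'I_m + 'I_n}|)%N by rewrite card_sum !card_ord addn_gt0 m0.
set N := #|{: 'I_m + 'I_n}| in mn0.
have ch0 : 0 < c * h by rewrite mulr_gt0.
have N0 : 0 < N%:R :> R by rewrite ltr0n.
(* Passing from 8 to 12 gives the strict gap [r < r'] of [finite_minimax]. *)
have [||x [N' [B [C [AE Bx Cx]]]] xle] :=
    @finite_minimax R _ (factorizable A) (N%:R * (8 * c * h)) (8 * c * h) (12 * c * h)
    (@factorizable_convex _ _ A) mn0.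
- by rewrite -!mulrA; lra.
- move=> w w0 w1.
  (* Adding [1 / N] makes the weights positive with total 2, and bounds every coordinate of [x] by
     [N (8 c h)]. *)
  pose w' i := w i + N%:R^-1.
  have w'0 i : 0 < w' i by rewrite ltr_wpDl ?invr_gt0.
  have sw' : \sum_i w' (inl i) + \sum_j w' (inr j) = 2.
    transitivity (\sum_i w' i); first by rewrite [RHS]big_sumType.
    by rewrite big_split /= w1 sumr_const -[_^-1 *+ _]mulr_natl divff ?gt_eqF.
  have [x [Ax x0 xle]] := weighted_factorization (ltW c0) minors
    (fun i => w'0 (inl i)) (fun j => w'0 (inr j)) sw'.
  have {}xle : \sum_i w' i * x i <= 8 * c * h by rewrite big_sumType.
  exists x; split=> //.
    move=> i; rewrite x0 /=; rewrite mulrC -ler_pdivrMr //; apply: le_trans xle.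
    rewrite (bigD1 i) //= mulrC -[X in X <= _]addr0; apply: lerD.
      by apply: ler_wpM2r => //; rewrite /w' lerDr.
    by apply: sumr_ge0 => j _; rewrite mulr_ge0 // ltW.
  apply: le_trans xle; apply: ler_sum => i _; apply: ler_wpM2r => //.
  by rewrite /w' lerDl invr_ge0 ltW.
- by exists N', B, C; split=> // i; [apply: le_trans (Bx i) _ | apply: le_trans (Cx i) _].
Qed.

End Factorization.

(** * The Gram-Schmidt walk *)

Section Projection.
Variables (R : realFieldType) (n : nat).
Implicit Types (U : 'M[R]_n) (t w g c : 'rV[R]_n).

(** Orthogonal projection onto the row space of [U], acting on row vectors from the right; the
    generalized inverse of the Gram matrix allows dependent rows. *)
Definition proj U : 'M[R]_n := U^T *m pinvmx (U *m U^T) *m U.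

(** A vector of the row space of [U] killed by [U^T] is orthogonal to itself, so [U *m U^T] keeps
    the rank of [U]. *)
Lemma trmx_sub_gram U : (U^T <= U *m U^T)%MS.
Proof.
rewrite -(geq_leqif (mxrank_leqif_sup (submxMl U U^T))) mxrank_tr.
rewrite -(mxrank_mul_ker U U^T) (_ : (_ :&: _)%MS = 0) ?mxrank0 ?addn0 //.
apply/eqP/rowV0P => v; rewrite sub_capmx => /andP [/submxP [D vE] /sub_kermxP vU].
by apply/eqP; rewrite -dot_eq0 {2}vE /dot trmx_mul mulmxA vU mul0mx mxE.
Qed.

Lemma proj_sub U t : (t *m proj U <= U)%MS.
Proof. by rewrite mulmxA submxMl. Qed.

Lemma proj_orth U t w : (w <= U)%MS -> dot (t - t *m proj U) w = 0.
Proof.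
move=> /submxP [D ->]; rewrite /dot trmx_mul mulmxA.
rewrite mulmxBl (_ : t *m proj U *m U^T = t *m U^T) ?subrr ?mul0mx ?mxE //.
have -> : t *m proj U *m U^T = t *m U^T *m pinvmx (U *m U^T) *m (U *m U^T).
  by rewrite /proj !mulmxA.
rewrite mulmxKpV //.
by apply: submx_trans (submxMl _ _) (trmx_sub_gram U).
Qed.

Lemma dot_proj U t w : (w <= U)%MS -> dot t w = dot (t *m proj U) w.
Proof. by move/(proj_orth t)/eqP; rewrite dotDl dotNl subr_eq0 => /eqP. Qed.

Definition energy U t := dot (t *m proj U) (t *m proj U).

Lemma energy_ge0 U t : 0 <= energy U t.
Proof. exact: dot_ge0. Qed.

Lemma energy_sub U1 U2 t : (U2 <= U1)%MS ->
  energy U1 t - energy U2 t =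
  dot (t *m proj U1 - t *m proj U2) (t *m proj U1 - t *m proj U2).
Proof.
move=> U21; have p2 := submx_trans (proj_sub U2 t) U21.
have E : dot (t *m proj U1) (t *m proj U2) = energy U2 t.
  by rewrite -dot_proj // (dot_proj _ (proj_sub U2 t)).
rewrite !(dotDl, dotDr, dotNl, dotNr) (dotC (t *m proj U2)) E /energy.
by ring.
Qed.

Lemma energy_le U1 U2 t : (U2 <= U1)%MS -> energy U2 t <= energy U1 t.
Proof. by move=> U21; rewrite -subr_ge0 energy_sub ?dot_ge0. Qed.

Lemma energy_le_dot U t : energy U t <= dot t t.
Proof.
have := dot_ge0 (t - t *m proj U).
rewrite !(dotDl, dotDr, dotNl, dotNr) (dotC (t *m _)) (dot_proj t (proj_sub U t)).
by rewrite -/(energy U t); lra.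
Qed.

(** [t] meets [g] only through the difference of its two projections, whose squared length is the
    energy drop. *)
Lemma energy_gain U1 U2 t g : (U2 <= U1)%MS -> (g <= U1)%MS ->
  (forall w, (w <= U2)%MS -> dot g w = 0) ->
  dot t g ^+ 2 <= dot g g * (energy U1 t - energy U2 t).
Proof.
move=> U21 gU1 gU2; rewrite energy_sub // mulrC (dot_proj t gU1).
have -> : dot (t *m proj U1) g = dot (t *m proj U1 - t *m proj U2) g.
  by rewrite dotDl dotNl (dotC (t *m proj U2)) (gU2 _ (proj_sub U2 t)) subr0.
exact: Cauchy_Schwarz.
Qed.

Definition resid U c := c - c *m proj U.

Lemma resid_orth U c w : (w <= U)%MS -> dot (resid U c) w = 0.
Proof. exact: proj_orth. Qed.

Lemma resid_sub U c : (resid U c <= U + c)%MS.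
Proof.
apply: addmx_sub; first exact: addsmxSr.
by rewrite eqmx_opp; apply: submx_trans (proj_sub U c) (addsmxSl _ _).
Qed.

Lemma dot_resid_le U c : dot (resid U c) (resid U c) <= dot c c.
Proof.
rewrite [X in _ <= X](_ : _ = dot (resid U c) (resid U c) + energy U c).
  by rewrite lerDl energy_ge0.
rewrite /energy /resid !(dotDl, dotDr, dotNl, dotNr) (dotC (c *m _) c).
by rewrite (dot_proj c (proj_sub U c)); ring.
Qed.

(** Dropping the pivot loses the energy along its residual, whose length is at most 1; this is the
    hypothesis of [walk_potential_end]. *)
Lemma energy_pivot U c t : dot c c <= 1 ->
  energy U t <= energy (U + c)%MS t - dot t (resid U c) * dot t (resid U c).
Proof.
move=> c1; set w := resid U c.
have H : dot t w ^+ 2 <= dot w w * (energy (U + c)%MS t - energy U t).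
  apply: energy_gain; [exact: addsmxSl | exact: resid_sub | exact: resid_orth].
have E := energy_le t (addsmxSl U c).
have w1 : dot w w <= 1 := le_trans (dot_resid_le U c) c1.
have w0 := dot_ge0 w.
by rewrite expr2 in H; nra.
Qed.

(** As [U] shrinks to [U'], the residual [w] gains a part [z] in [U] orthogonal to [w]. With [s],
    [r] the squared lengths of [w], [z], the energy [E] lost satisfies
    [(r a - s b)^2 <= r s (r + s) E], while [(r a - s b)^2 >= - 4 r s a b] and [r + s <= 1]. *)
Lemma energy_transition U U' c t : (U' <= U)%MS -> dot c c <= 1 ->
  - (2 * (dot t (resid U c) * (dot t (resid U' c) - dot t (resid U c)))) <=
  energy (U + c)%MS t - energy (U' + c)%MS t.
Proof.
move=> U'U c1.
have [w wE] : exists w, w = resid U c by eexists.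
have [w' w'E] : exists w', w' = resid U' c by eexists.
rewrite -wE -w'E.
have [z zE] : exists z, z = w' - w by eexists.
have -> : dot t w' - dot t w = dot t z by rewrite zE dotDr dotNr.
set a := dot t w; set b := dot t z.
have UU : (U' + c <= U + c)%MS by exact: addsmxS.
have mono := energy_le t UU.
have zU : (z <= U)%MS.
  have -> : z = c *m proj U - c *m proj U'.
    by rewrite zE wE w'E /resid opprB addrC addrA subrK addrC.
  apply: addmx_sub; first exact: proj_sub.
  by rewrite eqmx_opp; apply: submx_trans (proj_sub _ _) U'U.
have wz : dot w z = 0 by rewrite wE; exact: resid_orth.
have w'z : w' = w + z by rewrite zE addrC subrK.
pose s := dot w w; pose r := dot z z.
have s0 : 0 <= s by exact: dot_ge0.
have r0 : 0 <= r by exact: dot_ge0.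
have sr1 : s + r <= 1.
  apply: le_trans c1; apply: le_trans (dot_resid_le U' c).
  by rewrite -w'E w'z !(dotDl, dotDr) (dotC z w) wz add0r addr0.
have [|ab] := leP 0 (a * b); first by lra.
have sp : 0 < s.
  rewrite lt_neqAle eq_sym s0 andbT dot_eq0; apply: contraTneq ab => w0.
  by rewrite /a w0 dot0r mul0r ltxx.
have rp : 0 < r.
  rewrite lt_neqAle eq_sym r0 andbT dot_eq0; apply: contraTneq ab => z0.
  by rewrite /b z0 dot0r mulr0 ltxx.
(* The part of span(w, z) orthogonal to w' is lost when passing from U + c to U' + c. *)
pose g := r *: w - s *: z.
have gU : (g <= U + c)%MS.
  apply: addmx_sub; first by apply: scalemx_sub; rewrite wE; exact: resid_sub.
  by rewrite eqmx_opp; apply: scalemx_sub; apply: submx_trans zU (addsmxSl _ _).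
have gw' : dot g w' = 0.
  rewrite w'z /g !(dotDl, dotDr, dotNl, dotZl) (dotC z w) wz /s /r; ring.
have gU' v : (v <= U')%MS -> dot g v = 0.
  move=> vU'; have wv : dot w v = 0 by rewrite wE; apply: resid_orth; exact: submx_trans vU' U'U.
  have w'v : dot w' v = 0 by rewrite w'E; exact: resid_orth.
  have zv : dot z v = 0 by rewrite zE dotDl dotNl wv w'v subr0.
  by rewrite /g dotDl dotNl !dotZl wv zv !mulr0 subr0.
have gc : dot g c = 0.
  have -> : c = w' + c *m proj U' by rewrite w'E subrK.
  by rewrite dotDr gw' (gU' _ (proj_sub _ _)) addr0.
have := @energy_gain _ _ t g UU gU _.
have gg : dot g g = r * s * (s + r).
  rewrite /g !(dotDl, dotDr, dotNl, dotNr, dotZl, dotZr) (dotC z w) wz /s /r; ring.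
rewrite gg (_ : dot t g = r * a - s * b); last by rewrite /g dotDr dotNr !dotZr.
move=> H; have {}H : (r * a - s * b) ^+ 2 <=
    r * s * (s + r) * (energy (U + c)%MS t - energy (U' + c)%MS t).
  apply: H => v /sub_addsmxP [[u1 u2] /= ->]; rewrite dotDr gU' ?submxMl // add0r.
  by rewrite [u2]mx11_scalar mul_scalar_mx dotZr gc mulr0.
set E := energy _ _ - energy _ _ in H mono *.
have E0 : 0 <= E by rewrite subr_ge0.
have rs : 0 < r * s by rewrite mulr_gt0.
have le1 : r * s * (s + r) * E <= r * s * E.
  by rewrite -mulrA ler_pM2l // ler_piMl.
have le2 : r * s * - (2 * (a * b)) <= (r * a - s * b) ^+ 2.
  have := sqr_ge0 (r * a + s * b); have : 0 <= r * s * - (a * b).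
    by rewrite mulr_ge0 ?(ltW rs) //; lra.
  lra.
rewrite -(ler_pM2l rs); lra.
Qed.

End Projection.

Bind Scope ring_scope with R.
Local Arguments exp x%_ring_scope.
Local Arguments walk_potential (e a y)%_ring_scope.

(** * The walk: pivot phases until every element is coloured *)

Section Walk.
Variables (V T : finType) (n : nat) (c : V -> 'rV[R]_n) (th : T -> 'rV[R]_n).
Hypothesis c_le1 : forall v, dot (c v) (c v) <= 1.
Implicit Types (A : {set V}) (x : V -> R) (om : T -> R).

Lemma exp_ge0r (z : R) : 0 <= exp z.
Proof. by apply/RleP/Rlt_le/exp_pos. Qed.

Definition sgnr (b : bool) : R := if b then 1 else -1.

Definition spanm A : 'M[R]_n := (\sum_(v in A) <<c v>>)%MS.

Lemma spanm_vec A v : v \in A -> (c v <= spanm A)%MS.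
Proof. by move=> vA; apply: (sumsmx_sup v); rewrite ?genmxE. Qed.

Lemma spanmS A A' : A' \subset A -> (spanm A' <= spanm A)%MS.
Proof.
by move/subsetP => AA; apply/sumsmx_subP => v /AA vA; rewrite genmxE; exact: spanm_vec.
Qed.

Lemma spanmP A t : (t <= spanm A)%MS -> exists a : V -> R, t = \sum_(v in A) a v *: c v.
Proof.
move/sub_sumsmxP => [u ->].
have H v : exists a, u v *m <<c v>>%MS = a *: c v.
  by apply/sub_rVP; rewrite -(genmxE (c v)) submxMl.
have [a aE] := fin_all_exists H.
by exists a; apply: eq_bigr => v _; exact: aE.
Qed.

(** [tm v] is the time at which coordinate [v] reaches 1 or -1, and the least one is taken;
    [u p != 0] ensures that some coordinate moves. *)
Lemma boundary_step A x (u : V -> R) p : p \in A -> u p != 0 ->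
  (forall v, v \in A -> -1 < x v < 1) ->
  exists t, [/\ 0 <= t, forall v, v \in A -> -1 <= x v + t * u v <= 1 &
    exists2 v, v \in A & x v + t * u v = 1 \/ x v + t * u v = -1].
Proof.
move=> pA up xA.
pose tm v := if 0 < u v then (1 - x v) / u v else (-1 - x v) / u v.
pose P v := (v \in A) && (u v != 0).
have Pp : P p by rewrite /P pA.
have [v0 /andP [v0A u0] tmin] : exists2 v, P v & forall w, P w -> tm v <= tm w.
  by case: (arg_minP tm Pp) => v; exists v.
have tm_ge0 v : P v -> 0 <= tm v.
  move=> /andP [vA uv]; have /andP [x1 x2] := xA v vA; rewrite /tm.
  case: ltP => u1; first by apply: divr_ge0; lra.
  by rewrite -mulrNN -invrN; apply: divr_ge0; lra.
have t0 : 0 <= tm v0 by apply: tm_ge0; rewrite /P v0A.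
exists (tm v0); split=> //.
  move=> v vA; have /andP [x1 x2] := xA v vA.
  have [->|uv] := eqVneq (u v) 0; first by rewrite mulr0; lra.
  have := tmin v; rewrite /P vA uv => /(_ isT); rewrite {2}/tm.
  case: ltP => u1.
    rewrite ler_pdivlMr // => H.
    have : 0 <= tm v0 * u v by rewrite mulr_ge0 // ltW.
    lra.
  have u1' : u v < 0 by rewrite lt_neqAle uv.
  rewrite ler_ndivlMr // => H.
  have : tm v0 * u v <= 0 by rewrite mulr_ge0_le0 // ltW.
  lra.
exists v0 => //; rewrite /tm; case: ifP => _; rewrite divfK //; [left | right]; ring.
Qed.

Let res A p := resid (spanm A) (c p).
Let pot A p x t : R :=
  walk_potential (energy (spanm A + c p)%MS (th t)) (dot (th t) (res A p)) (x p).

(** Induction statement on the number of live elements besides the pivot. The weights [om] are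
    arbitrary so as to absorb the exponentials of earlier moves. *)
Definition pivot_ok (N : nat) := forall A p x om, (#|A| < N)%N -> p \notin A ->
  (forall v, v \in p |: A -> -1 < x v < 1) -> (forall t, 0 <= om t) ->
  exists e : V -> bool,
    \sum_t om t * exp (dot (th t) (\sum_(v in p |: A) (sgnr (e v) - x v) *: c v)) <=
    \sum_t om t * pot A p x t.

(** Any live element may open a phase as pivot: by [walk_potential_start] its potential is at most
    [exp] of half the energy of the live columns. *)
Lemma phase_start N : pivot_ok N -> forall A x om, (#|A| <= N)%N ->
  (forall v, v \in A -> -1 < x v < 1) -> (forall t, 0 <= om t) ->
  exists e : V -> bool,
    \sum_t om t * exp (dot (th t) (\sum_(v in A) (sgnr (e v) - x v) *: c v)) <=
    \sum_t om t * exp (energy (spanm A) (th t) / 2).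
Proof.
move=> IH A x om AN xA om0.
have [->|[p pA]] := set_0Vmem A.
  exists xpredT; apply: ler_sum => t _; rewrite ler_wpM2l // big_set0 dot0r.
  by apply/RleP; apply: exp_le; apply/RleP; apply: divr_ge0; rewrite ?energy_ge0.
have AE : A = p |: A :\ p by rewrite setD1K.
have [||||e eP] := IH (A :\ p) p x om.
- by apply: leq_trans AN; rewrite [in leqRHS](cardsD1 p) pA.
- by rewrite !inE eqxx.
- by rewrite -AE.
- by [].
exists e; rewrite {1}AE; apply: le_trans eP _; apply: ler_sum => t _.
rewrite ler_wpM2l //; apply: (@le_trans _ _
    (exp (energy (spanm (A :\ p) + c p)%MS (th t) / 2))).
  have /andP [x1 x2] := xA p pA.
  by apply/RleP; apply: walk_potential_start; split; apply/RleP; exact: ltW.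
apply/RleP; apply: exp_le; apply/RleP; rewrite ler_wpM2r ?invr_ge0 //.
apply: energy_le; rewrite addsmx_sub spanm_vec // andbT.
by apply: spanmS; exact: subD1set.
Qed.

(** One move, then induction. If the pivot survives, another element froze and the phase goes on; if
    the pivot froze, a new phase starts on the remaining elements. *)
Lemma pivot_all N : pivot_ok N.
Proof.
elim: N => // N IH A p x om AN pA xB om0; set B := p |: A.
have pB : p \in B by rewrite setU11.
have [a aE] := spanmP (proj_sub (spanm A) (c p)).
(* Moving the colouring along [u] moves the vector sum along the residual of the pivot column. *)
pose u v : R := if v == p then 1 else - a v.
have uE : \sum_(v in B) u v *: c v = res A p.
  rewrite /B big_setU1 //= /u eqxx scale1r /res /resid aE -sumrN; congr (_ + _).
  apply: eq_bigr => v vA; rewrite (negbTE (_ : v != p)) ?scaleNr //.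
  by apply: contraNneq pA => <-.
have [K KE] : exists K : T -> R, forall t d,
    exp (d * dot (th t) (res A p)) *
      walk_potential (energy (spanm A + c p)%MS (th t)) (dot (th t) (res A p)) (x p + d) =
    pot A p x t + d * K t.
  apply: (@fin_all_exists T (fun=> R) (fun t k => forall d,
    exp (d * dot (th t) (res A p)) *
      walk_potential (energy (spanm A + c p)%MS (th t)) (dot (th t) (res A p)) (x p + d) =
    pot A p x t + d * k)) => t.
  exact: walk_potential_shift.
(* The weighted potential is affine in the displacement [d] of the pivot; the sign [sg] is taken
   against its slope. *)
pose slope : R := \sum_t om t * K t.
pose sg : R := if slope <= 0 then 1 else -1.
have sg_slope : sg * slope <= 0 by rewrite /sg; case: (leP slope 0) => H; lra.
have [|d0 [d0_ge0 xd [v0 v0B hit]]] := @boundary_step B x (fun v => sg * u v) p pB _ xB.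
  by rewrite /u eqxx mulr1 /sg; case: ifP => _; rewrite ?oppr_eq0 oner_eq0.
pose d := d0 * sg; pose x' v := x v + d * u v.
have x'E v : x v + d0 * (sg * u v) = x' v by rewrite /x' /d mulrA.
have {xd} x'B v : v \in B -> -1 <= x' v <= 1 by rewrite -x'E; exact: xd.
have {hit} hit : x' v0 = 1 \/ x' v0 = -1 by rewrite -x'E.
pose om' t := om t * exp (d * dot (th t) (res A p)).
have om'0 t : 0 <= om' t by rewrite mulr_ge0 ?exp_ge0r.
pose B' := [set v in B | -1 < x' v < 1].
have x'p : x' p = x p + d by rewrite /x' /u eqxx mulr1.
have x'B' v : v \in B' -> -1 < x' v < 1 by rewrite inE => /andP [].
suff [e eP] : exists e : V -> bool,
    \sum_t om' t * exp (dot (th t) (\sum_(v in B') (sgnr (e v) - x' v) *: c v)) <=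
    \sum_t om' t * pot A p x' t.
  exists (fun v => if v \in B' then e v else x' v == 1).
  apply: (@le_trans _ _ (\sum_t om' t * pot A p x' t)).
    apply: le_trans eP; apply: ler_sum => t _.
    rewrite /om' -mulrA ler_wpM2l // (_ : exp _ * exp _ = exp (d * dot (th t) (res A p) +
      dot (th t) (\sum_(v in B') (sgnr (e v) - x' v) *: c v))); last by rewrite expRD.
    suff -> : \sum_(v in B) (sgnr (if v \in B' then e v else x' v == 1) - x v) *: c v =
        d *: res A p + \sum_(v in B') (sgnr (e v) - x' v) *: c v.
      by rewrite dotDr dotZr.
    rewrite -uE scaler_sumr [X in _ = _ + X](eq_bigl (fun v => (v \in B) && (-1 < x' v < 1)));
      last by move=> v; rewrite inE.
    rewrite [X in _ = _ + X]big_mkcondr -big_split /=; apply: eq_bigr => v vB.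
    rewrite scalerA; have /andP [x1 x2] := x'B v vB.
    rewrite inE vB /=; case: ifP => xv.
      by rewrite -scalerDl; congr (_ *: _); rewrite /x'; ring.
    rewrite addr0; congr (_ *: _).
    have -> : sgnr (x' v == 1) = x' v; last by rewrite /x'; ring.
    rewrite /sgnr; case: eqVneq => [->//|ne1].
    have lt1 : x' v < 1 by rewrite lt_neqAle ne1.
    by move: xv; rewrite lt1 andbT => /negbT; rewrite -leNgt; lra.
  under eq_bigr do rewrite /om' /pot x'p -mulrA KE mulrDr.
  rewrite big_split /= gerDl.
  have -> : \sum_t om t * (d * K t) = d0 * (sg * slope).
    by rewrite /slope !mulr_sumr; apply: eq_bigr => t _; rewrite /d; ring.
  by rewrite mulr_ge0_le0.
have [pB'|pB'] := boolP (p \in B').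
  pose A' := B' :\ p.
  have A'A : A' \subset A.
    apply/subsetP => v; rewrite !inE => /andP [vp /andP [/orP [/eqP vp'|//] _]].
    by rewrite vp' eqxx in vp.
  have B'E : B' = p |: A' by rewrite setD1K.
  have v0B' : v0 \notin B'.
    by rewrite inE v0B /=; case: hit => ->; rewrite ltxx ?andbF.
  have v0A : v0 \in A.
    move: v0B; rewrite !inE => /orP [/eqP v0p|//].
    by rewrite v0p pB' in v0B'.
  have A'N : (#|A'| < N)%N.
    rewrite -ltnS; apply: leq_trans AN; rewrite ltnS; apply: proper_card.
    apply/properP; split=> //; exists v0 => //.
    by apply: contra v0B'; rewrite !inE => /andP [].
  have [||||e eP] := IH A' p x' om'.
  - by [].
  - by rewrite !inE eqxx.
  - by rewrite -B'E.
  - by [].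
  exists e; rewrite B'E; apply: le_trans eP _; apply: ler_sum => t _.
  rewrite ler_wpM2l // /pot; have /andP [x1 x2] := x'B p pB.
  have sA := spanmS A'A.
  apply/RleP; apply: walk_potential_transition; first by split; exact/RleP.
    by apply/RleP; apply: energy_le; apply: addsmxS.
  by apply/RleP; exact: energy_transition.
have B'A : B' \subset A.
  apply/subsetP => v vB'; have : v \in B by move: vB'; rewrite inE => /andP [].
  by rewrite !inE => /orP [/eqP vp|//]; rewrite vp (negbTE pB') in vB'.
have [|||e eP] := phase_start IH (A := B') (x := x') (om := om').
- by rewrite -ltnS; apply: leq_trans AN; rewrite ltnS subset_leq_card.
- exact: x'B'.
- exact: om'0.
exists e; apply: le_trans eP _; apply: ler_sum => t _; rewrite ler_wpM2l // /pot.
apply/RleP; apply: walk_potential_end.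
  move: pB'; rewrite inE pB /= negb_and -!leNgt.
  have /andP [x1 x2] := x'B p pB.
  by case/orP => H; [right | left]; apply: le_anti; rewrite ?H ?x1 ?x2.
apply/RleP; apply: le_trans (energy_pivot _ _ (c_le1 p)).
by apply: energy_le; exact: spanmS.
Qed.

Lemma gram_schmidt_walk (J : {set V}) : exists e : V -> bool,
  \sum_t exp (dot (th t) (\sum_(v in J) sgnr (e v) *: c v)) <=
  \sum_t exp (dot (th t) (th t) / 2).
Proof.
have [||e eP] := phase_start (@pivot_all #|J|) (A := J) (x := fun=> 0) (om := fun=> 1) (leqnn _).
- by move=> v _; rewrite ltrN10 ltr01.
- by move=> t; exact: ler01.
exists e; move: eP; under eq_bigr do rewrite mul1r.
under [X in _ -> X <= _]eq_bigr do under eq_bigr do rewrite -[sgnr _]subr0.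
move/le_trans; apply; apply: ler_sum => t _; rewrite mul1r.
apply/RleP; apply: exp_le; apply/RleP; rewrite ler_wpM2r ?invr_ge0 //.
exact: energy_le_dot.
Qed.

End Walk.

(** * Factorizations of set systems *)

Local Arguments ln x%_ring_scope.

Lemma ler_ln (a b : R) : 0 < a -> a <= b -> ln a <= ln b.
Proof.
move=> /RltP a0 /RleP [ab|->] //; apply/RleP/Rlt_le.
exact: ln_increasing.
Qed.

Lemma ln_succ_ge0 m : 0 <= ln m.+1%:R :> R.
Proof. by rewrite -[X in X <= _](_ : ln 1 = 0) ?ler_ln ?ler1n //; exact: ln_1. Qed.

(** [ln (m + 2) - ln (m + 1) >= 1 / (m + 2) >= 1 / (2 (m + 1))], from [ln z <= z - 1] at
    [z = (m + 1) / (m + 2)]. *)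
Lemma harmonic_le_ln m : \sum_(i < m) (i.+1%:R : R)^-1 <= 2 * ln m.+1%:R.
Proof.
elim: m => [|m IH].
  by rewrite big_ord0 mulr_ge0 // (_ : ln _ = 0) //; exact: ln_1.
rewrite big_ord_recr /=; set a : R := m.+1%:R in IH *; set b : R := m.+2%:R.
have a0 : 0 < a by rewrite ltr0n.
have b0 : 0 < b by rewrite ltr0n.
have bE : b = a + 1 by rewrite /a /b -natr1.
have a1 : 1 <= a by rewrite ler1n.
have lnD : ln b = ln a - ln (a / b).
  have -> : ln (a / b) = ln a + - ln b.
    have b0' : Rlt (IZR 0) b by exact/RltP.
    have <- : ln b^-1 = - ln b := ln_Rinv b b0'.
    apply: ln_mult; first exact/RltP.
    by apply/RltP; rewrite invr_gt0.
  by rewrite opprD opprK addrA subrr add0r.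
have ln_ub : ln (a / b) <= a / b - 1.
  have ab0 : 0 < a / b by rewrite divr_gt0.
  have /RleP := exp_ineq1_le (ln (a / b)).
  by rewrite exp_ln; [move=> H; rewrite lerBrDl | exact/RltP].
have : a^-1 <= 2 * (1 - a / b); last first.
  rewrite lnD => H; apply: le_trans (lerD IH H) _.
  by move: ln_ub; move: (ln (a / b)) (a / b) (ln a) => x y z; lra.
have -> : 2 * (1 - a / b) = 2 / b.
  have bn : b != 0 by rewrite gt_eqF.
  by rewrite -[X in X - _](divff bn) -mulrBl (_ : b - a = 1) ?mul1r // bE addrAC subrr add0r.
rewrite ler_pdivlMr // mulrC ler_pdivrMr //; lra.
Qed.

(** * From discrepancy to factorizations of set systems and back *)

Section FamilyFactorization.
Variable V : finType.
Implicit Types F : {set {set V}}.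

(** The vectors are indexed by sets and points instead of matrix indices, so that factorizations of
    different families can be concatenated. *)
Definition gram_factors F N (b : {set V} -> 'rV[R]_N) (c : V -> 'rV[R]_N) (r : R) :=
  [/\ forall S v, S \in F -> dot (b S) (c v) = (v \in S)%:R,
      forall S, S \in F -> dot (b S) (b S) <= r & forall v, dot (c v) (c v) <= r].

Lemma herdisc_factorization F : exists N b c,
  @gram_factors F N b c (72 * (ln #|F|.+1%:R * (herdisc F)%:R)).
Proof.
have [h0|h0] := posnP (herdisc F).
  exists 0%N, (fun=> 0), (fun=> 0); rewrite h0 !mulr0; split=> [S v SF|*|*]; rewrite dot0l //.
  by rewrite (herdisc_eq0 h0 SF) inE.
have [F0|[S0 S0F]] := set_0Vmem F.
  have : (herdisc F)%:R <= 0 :> R.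
    by apply: herdisc_le => // J; exists [ffun=> true] => S; rewrite F0 inE.
  by rewrite lern0 => /eqP h; rewrite h in h0.
pose A : 'M[R]_(#|F|, #|V|) :=
  \matrix_(i, j) ((enum_val (j : 'I_#|V|) : V) \in (enum_val (i : 'I_#|F|) : {set V}))%:R.
have minors k (f : 'I_k -> 'I_#|F|) (g : 'I_k -> 'I_#|V|) :
    `|\det (mxsub f g A)| <= (3 * (herdisc F)%:R) ^+ k.
  have := @det_le_herdisc V F k (fun i => enum_val (f i)) (fun j => enum_val (g j))
    (fun i => enum_valP (f i)) h0.
  set B := \matrix_(i, j) _ => H.
  have -> : mxsub f g A = map_mx intr B.
    by apply/matrixP => i j; rewrite !mxE; case: (_ \in _).
  rewrite det_map_mx -intr_norm.
  have -> : (3 * (herdisc F)%:R) ^+ k = ((3 * (herdisc F)%:Z) ^+ k)%:~R :> R.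
    by rewrite rmorphXn rmorphM /=.
  by rewrite ler_int.
have m0 : (0 < #|F|)%N by apply/card_gt0P; exists S0.
have c0 : 0 < 3 * (herdisc F)%:R :> R by rewrite mulr_gt0 ?ltr0n.
have [N [B [C [AE Bx Cx]]]] := minors_factorization c0 m0 minors.
(* [72 = 12 * 3 * 2]: from the minimax, the minors and the harmonic sum. *)
have bound : 12 * (3 * (herdisc F)%:R) * \sum_(i < #|F|) (i.+1%:R : R)^-1 <=
    72 * (ln #|F|.+1%:R * (herdisc F)%:R).
  have -> : 72 * (ln #|F|.+1%:R * (herdisc F)%:R) =
      12 * (3 * (herdisc F)%:R) * (2 * ln #|F|.+1%:R) :> R by ring.
  apply: ler_wpM2l; last exact: harmonic_le_ln.
  by rewrite mulr_ge0 // ltW.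
pose idx S := enum_rank_in S0F S.
exists N, (fun S => row (idx S) B), (fun v => row (enum_rank v) C^T); split.
- move=> S v SF; rewrite dotE.
  have /matrixP/(_ (idx S) (enum_rank v)) := AE.
  rewrite !mxE enum_rankK /idx enum_rankK_in // => ->.
  by apply: eq_bigr => k _; rewrite !mxE.
- move=> S SF; apply: le_trans bound; apply: le_trans (Bx (idx S)).
  by rewrite dotE; apply: ler_sum => k _; rewrite !mxE -expr2.
- move=> v; apply: le_trans bound; apply: le_trans (Cx (enum_rank v)).
  by rewrite dotE; apply: ler_sum => k _; rewrite !mxE -expr2.
Qed.

Lemma dot_mxrow t (p : 'I_t -> nat) (u w : forall i, 'rV[R]_(p i)) :
  dot (\mxrow_i u i) (\mxrow_i w i) = \sum_i dot (u i) (w i).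
Proof. by rewrite /dot tr_mxrow mul_mxrow_mxcol summxE. Qed.

Lemma union_factorization t (Fs : 'I_t -> {set {set V}}) F :
  (forall S, S \in F -> exists Fi : 'I_t -> {set V},
     (forall i, Fi i \in Fs i) /\
     (forall i j, i != j -> [disjoint Fi i & Fi j]) /\
     S = \bigcup_(i < t) Fi i) ->
  exists N b c, @gram_factors F N b c
    (72 * \sum_(i < t) ln #|Fs i|.+1%:R * (herdisc (Fs i))%:R).
Proof.
move=> decomp.
have [d dP] : exists d : {set V} -> 'I_t -> {set V}, forall S, S \in F ->
    [/\ forall i, d S i \in Fs i, forall i j, i != j -> [disjoint d S i & d S j] &
        S = \bigcup_(i < t) d S i].
  apply: (@fin_all_exists {set V} (fun=> 'I_t -> {set V}) (fun S d => S \in F ->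
    [/\ forall i, d i \in Fs i, forall i j, i != j -> [disjoint d i & d j] &
        S = \bigcup_(i < t) d i])) => S.
  have [SF|SF] := boolP (S \in F); last by exists (fun=> set0).
  by have [d [? [? ?]]] := decomp S SF; exists d.
pose r i : R := 72 * (ln #|Fs i|.+1%:R * (herdisc (Fs i))%:R).
pose X := {N : nat & (({set V} -> 'rV[R]_N) * (V -> 'rV[R]_N))%type}.
have [x xP] : exists x : 'I_t -> X, forall i,
    gram_factors (Fs i) (tagged (x i)).1 (tagged (x i)).2 (r i).
  apply: (@fin_all_exists 'I_t (fun=> X) (fun i x =>
    gram_factors (Fs i) (tagged x).1 (tagged x).2 (r i))) => i.
  have [N [b [c bc]]] := herdisc_factorization (Fs i).
  by exists (existT (fun N => (({set V} -> 'rV[R]_N) * (V -> 'rV[R]_N))%type) N (b, c)).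
(* Block [i] of the vector of [S] comes from the piece [d S i]; squared lengths of blocks add up. *)
exists (\sum_i tag (x i))%N, (fun S => \mxrow_i (tagged (x i)).1 (d S i)),
  (fun v => \mxrow_i (tagged (x i)).2 v).
rewrite mulr_sumr; split.
- move=> S v SF; have [dF dd SE] := dP S SF; rewrite dot_mxrow.
  rewrite (eq_bigr (fun i => (v \in d S i)%:R)); last first.
    by move=> i _; have [E _ _] := xP i; rewrite E.
  (* By disjointness a point of [S] lies in exactly one piece, so exactly one block contributes
     1. *)
  have [vS|vS] := boolP (v \in S).
    move: vS; rewrite {1}SE => /bigcupP [i _ vi].
    rewrite (bigD1 i) //= vi big1 ?addr0 // => j ji.
    have /disjoint_setI0/setP/(_ v) := dd j i ji.
    by rewrite !inE vi andbT => ->.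
  rewrite big1 // => i _; case: (boolP (v \in d S i)) => // vi.
  by case/negP: vS; rewrite SE; apply/bigcupP; exists i.
- move=> S SF; have [dF _ _] := dP S SF; rewrite dot_mxrow; apply: ler_sum => i _.
  by have [_ + _] := xP i; apply.
- move=> v; rewrite dot_mxrow; apply: ler_sum => i _.
  by have [_ _] := xP i; apply.
Qed.

(** The walk runs on the columns divided by [sqrt r], tested against both signs of each [b S] scaled
    by [L / sqrt r]. One test is at most the whole sum, which bounds every signed set sum by
    [r L]. *)
Lemma factorization_herdisc F N b c (r : R) : 0 <= r -> @gram_factors F N b c r ->
  (herdisc F)%:R <= 2 * r * sqrt (ln #|F|.+1%:R).
Proof.
move=> r0 [bc bb cc].
have lnF0 := ln_succ_ge0 #|F|.
have s0 : 0 <= sqrt (ln #|F|.+1%:R) :> R by apply/RleP; exact: sqrt_pos.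
apply: herdisc_le => [|J]; first by rewrite !mulr_ge0.
have [F0|[S0 S0F]] := set_0Vmem F.
  by exists [ffun=> true] => S; rewrite F0 inE.
have m0 : (0 < #|F|)%N by apply/card_gt0P; exists S0.
have [rE|rn0] := eqVneq r 0.
  exists [ffun=> true] => S SF; rewrite big_pred0 ?normr0 ?rE ?mulr0 ?mul0r //.
  move=> v; rewrite inE; apply/negP => /andP [vS _].
  have b0 : b S = 0.
    by apply/eqP; rewrite -dot_eq0 eq_le dot_ge0 andbT -rE bb.
  have := bc S v SF; rewrite b0 dot0l vS => /esym/eqP; apply/negP.
  exact: oner_neq0.
have rp : 0 < r by rewrite lt_neqAle eq_sym rn0.
(* Chosen so that the number [2 |F|] of tests equals [exp (L^2 / 2)]; the sum over all tests is then
   at most [exp (L^2)]. *)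
pose L : R := Num.sqrt (2 * ln (#|F| * 2)%:R).
have ln2m : 0 < ln (#|F| * 2)%:R :> R.
  apply/RltP; have <- : ln 1 = 0 := ln_1; apply: ln_increasing; first exact: Rlt_0_1.
  by apply/RltP; rewrite (ltr_nat _ 1); lia.
have L2 : L ^+ 2 = 2 * ln (#|F| * 2)%:R by rewrite sqr_sqrtr // mulr_ge0 // ltW.
have Lp : 0 < L by rewrite sqrtr_gt0 mulr_gt0.
pose rt : R := Num.sqrt r.
have rt2 : rt ^+ 2 = r by rewrite sqr_sqrtr.
have rtp : 0 < rt by rewrite sqrtr_gt0.
pose c' v := rt^-1 *: c v.
have c'1 v : dot (c' v) (c' v) <= 1.
  by rewrite dotZl dotZr mulrA -expr2 exprVn rt2 mulrC ler_pdivrMr // mul1r.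
pose th (i : 'I_#|F| * bool) := (sgnr i.2 * (L / rt)) *: b (enum_val i.1).
have [e eP] := gram_schmidt_walk th c'1 J.
exists (finfun e) => S SF.
set X := \sum_(v in S :&: J) sgnc _ v.
have XE : (absz X)%:R = `|X%:~R| :> R by rewrite -intr_norm -abszE.
have dotX i s : enum_val i = S ->
    dot (th (i, s)) (\sum_(v in J) sgnr (e v) *: c' v) = sgnr s * (L / r) * X%:~R.
  move=> iS; rewrite dotC dot_suml /= /X rmorph_sum /=.
  rewrite [X in _ = _ * X](eq_bigl (fun v => (v \in J) && (v \in S)));
    last by move=> v; rewrite inE andbC.
  rewrite big_mkcondr mulr_sumr; apply: eq_bigr => v _.
  rewrite /c' !dotZl dotC dotZl iS bc // -rt2 /sgnc ffunE /sgnr.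
  by case: (v \in S); case: (e v) => /=; field; rewrite gt_eqF.
have sum_le : \sum_t exp (dot (th t) (th t) / 2) <= (#|F| * 2)%:R * exp (L ^+ 2 / 2).
  have -> : (#|F| * 2)%:R * exp (L ^+ 2 / 2) =
      \sum_(t : 'I_#|F| * bool) exp (L ^+ 2 / 2).
    by rewrite sumr_const card_prod card_ord card_bool mulr_natl.
  apply: ler_sum => -[i s] _; apply/RleP; apply: exp_le; apply/RleP.
  rewrite ler_wpM2r ?invr_ge0 // dotZl dotZr mulrA.
  have -> : sgnr s * (L / rt) * (sgnr s * (L / rt)) = L ^+ 2 / r.
    by rewrite -rt2 /sgnr; case: s; field; rewrite gt_eqF.
  rewrite mulrAC ler_pdivrMr // ler_wpM2l ?sqr_ge0 //.
  by apply: bb; exact: enum_valP.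
have one s : sgnr s * (L / r) * X%:~R <= L ^+ 2.
  have le1 : exp (sgnr s * (L / r) * X%:~R) <= (#|F| * 2)%:R * exp (L ^+ 2 / 2).
    apply: le_trans sum_le; apply: le_trans eP.
    rewrite (bigD1 (enum_rank_in SF S, s)) //= dotX ?enum_rankK_in // lerDl.
    by apply: sumr_ge0 => t _; exact: exp_ge0r.
  have le2 : exp (sgnr s * (L / r) * X%:~R) <= exp (L ^+ 2).
    apply: le_trans le1 _.
    have -> : (#|F| * 2)%:R = exp (L ^+ 2 / 2).
      have -> : L ^+ 2 / 2 = ln (#|F| * 2)%:R by rewrite L2; field.
      rewrite exp_ln //.
      by apply/RltP; rewrite ltr0n; lia.
    have -> : exp (L ^+ 2 / 2) * exp (L ^+ 2 / 2) = exp (L ^+ 2 / 2 + L ^+ 2 / 2).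
      by rewrite expRD.
    by rewrite -splitr.
  apply/RleP; apply: Rnot_lt_le => lt; move/RleP: le2; apply: Rlt_not_le.
  exact: exp_increasing.
have Xle : `|X%:~R| <= r * L.
  have H s : sgnr s * X%:~R <= r * L.
    have Lr : 0 < L / r by rewrite divr_gt0.
    rewrite -(ler_pM2l Lr) mulrA [L / r * _]mulrC; apply: le_trans (one s) _.
    by rewrite mulrA divfK ?gt_eqF // expr2.
  have := H true; have := H false; rewrite /sgnr ler_norml mul1r mulN1r => h1 h2.
  by rewrite h2 andbT lerNl.
rewrite XE; apply: le_trans Xle _; rewrite (mulrC 2) -mulrA ler_wpM2l //.
rewrite -(@ler_pXn2r _ 2) ?nnegrE ?mulr_ge0 ?(ltW Lp) // L2 exprMn RsqrtE sqr_sqrtr //.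
have : ln (#|F| * 2)%:R <= 2 * ln #|F|.+1%:R; last by lra.
have -> : 2 * ln #|F|.+1%:R = ln (#|F|.+1%:R * #|F|.+1%:R).
  have mp : Rlt (IZR 0) (#|F|.+1%:R) by apply/RltP; rewrite ltr0n.
  by rewrite [RHS](ln_mult _ _ mp mp) mulr_natl mulr2n.
(* [2 m <= (m + 1)^2] for the number [m] of sets. *)
by apply: ler_ln; rewrite ?ltr0n -?natrM ?ler_nat; nia.
Qed.

End FamilyFactorization.

(** 144 is the 2 of [factorization_herdisc] times the 72 of [union_factorization]. *)
Lemma herdisc_union (V : finType) t (Fs : 'I_t -> {set {set V}}) (F : {set {set V}}) :
  (forall S, S \in F -> exists Fi : 'I_t -> {set V},
     (forall i, Fi i \in Fs i) /\
     (forall i j, i != j -> [disjoint Fi i & Fi j]) /\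
     S = \bigcup_(i < t) Fi i) ->
  INR (herdisc F) <= 144 * sqrt (ln (INR #|F|.+1)) *
    \sum_(i < t) ln (INR #|Fs i|.+1) * INR (herdisc (Fs i)).
Proof.
move=> decomp; have [N [b [c bc]]] := union_factorization decomp.
rewrite !INRE; under eq_bigr do rewrite !INRE.
set s := \sum_(i < t) _ in bc *.
have s0 : 0 <= 72 * s.
  rewrite mulr_ge0 // sumr_ge0 // => i _; rewrite mulr_ge0 ?ler0n //.
  exact: ln_succ_ge0.
have := factorization_herdisc s0 bc; congr (_ <= _); ring.
Qed.

From Stdlib Require Import Reals.

(** Logarithms are taken of the size plus one, so that a family with a single set does not give a
    factor zero. *)
Theorem theorem5p2 :
  exists C : R, (0 < C)%R /\
  forall (V : finType) (t : nat) (Fs : 'I_t -> {set {set V}})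
         (F : {set {set V}}),
    (forall S, S \in F ->
       exists Fi : 'I_t -> {set V},
         (forall i, Fi i \in Fs i) /\
         (forall i j, i != j -> [disjoint Fi i & Fi j]) /\
         S = \bigcup_(i < t) Fi i) ->
    (INR (herdisc F) <=
       C * sqrt (ln (INR #|F|.+1)) *
       \big[Rplus/0%R]_(i < t)
          (ln (INR #|Fs i|.+1) * INR (herdisc (Fs i))))%R.
Proof.
exists 144%:R; split; first by apply/RltP.
by move=> V t Fs F decomp; apply/RleP; exact: herdisc_union.
Qed.
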